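(* There are infinitely many periodic non-trivial solutions (i.e. periodic solutions $(x,y,z)$ for which $x$ is not identically $0$) of the three-body problem in the family $\mathbb{B}$ defined in the context.
   Context: The gravitational constant is $1$. The three-body problem with masses $m_1,m_2,m_2>0$ is $$\ddot x=\frac{m_2(y-x)}{|y-x|^3}+\frac{m_2(z-x)}{|z-x|^3},\quad \ddot y=\frac{m_1(x-y)}{|x-y|^3}+\frac{m_2(z-y)}{|z-y|^3},\quad \ddot z=\frac{m_1(x-z)}{|x-z|^3}+\frac{m_2(y-z)}{|y-z|^3}$$ for $x,y,z$ with values in $\mathbb{R}^3$. For a parameter $q=(y_{10},dy_{20},df_0,m_1,m_2)\in\mathbb{R}^5$ with $y_{10},m_1,m_2>0$, consider the solution with initial conditions $$x(0)=(0,0,0),\quad y(0)=(y_{10},0,0),\quad z(0)=(-y_{10},0,0),$$ $$\dot x(0)=(0,0,df_0),\quad \dot y(0)=\Big(0,dy_{20},-\tfrac{m_1df_0}{2m_2}\Big),\quad \dot z(0)=\Big(0,-dy_{20},-\tfrac{m_1df_0}{2m_2}\Big).$$ Put $$c_1=y_{10}\,dy_{20},\qquad c_2=m_2\,dy_{20}^2-\frac{m_2}{2y_{10}}(4m_1+m_2)+\frac{m_1}{4m_2}(m_1+2m_2)\,df_0^2$$ ($c_2$ is the total energy). The family $\mathbb{L}$ consists of all such solutions (over all such $q$, the masses included among the parameters) with $c_2<0$ and $c_1\neq 0$; these are defined for all $t\in\mathbb{R}$. The family $\mathbb{B}$ consists of those solutions in $\mathbb{L}$ with $8m_1m_2^2+m_2^3+16c_2c_1^2<0$.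 A solution is periodic if there is $T>0$ with $x(t+T)=x(t)$, $y(t+T)=y(t)$, $z(t+T)=z(t)$ for all $t$. *)

(* Defs.v *)
From Stdlib Require Import Reals Ensembles Finite_sets Lra.
From Coquelicot Require Import Coquelicot.
Open Scope R_scope.

(* Coquelicot's norm on a product is the l^2 norm, so [norm] on [R3] is the
   Euclidean norm (lemma [norm_R3]). *)
Definition R3 : NormedModule R_AbsRing :=
  prod_NormedModule R_AbsRing
    (prod_NormedModule R_AbsRing R_NormedModule R_NormedModule) R_NormedModule.

Definition vec3 (a b c : R) : R3 := (a, b, c).

Lemma norm_R3 (a b c : R) : norm (vec3 a b c) = sqrt (a ^ 2 + b ^ 2 + c ^ 2).
Proof.
assert (H : forall r : R, @norm R_AbsRing R_NormedModule r ^ 2 = r ^ 2)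
  by (intro r; apply pow2_abs).
change (sqrt (sqrt (@norm R_AbsRing R_NormedModule a ^ 2
                    + @norm R_AbsRing R_NormedModule b ^ 2) ^ 2
              + @norm R_AbsRing R_NormedModule c ^ 2)
        = sqrt (a ^ 2 + b ^ 2 + c ^ 2)).
rewrite !H, pow2_sqrt; [reflexivity |].
generalize (pow2_ge_0 a) (pow2_ge_0 b); lra.
Qed.

(* Acceleration of a body at [a] caused by a mass [m] at [b]. *)
Definition attraction (m : R) (a b : R3) : R3 :=
  scal (m / norm (minus b a) ^ 3) (minus b a).

(* Global solutions of the three-body problem with masses m1, m2, m2, together
   with their velocities [vx], [vy], [vz].  Collisions are excluded explicitly
   because division by zero is total. *)
Definition three_body_solution (m1 m2 : R) (x y z vx vy vz : R -> R3) : Prop :=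
  forall t : R,
    (x t <> y t /\ x t <> z t /\ y t <> z t) /\
    (is_derive x t (vx t) /\ is_derive y t (vy t) /\ is_derive z t (vz t)) /\
    is_derive vx t (plus (attraction m2 (x t) (y t)) (attraction m2 (x t) (z t))) /\
    is_derive vy t (plus (attraction m1 (y t) (x t)) (attraction m2 (y t) (z t))) /\
    is_derive vz t (plus (attraction m1 (z t) (x t)) (attraction m2 (z t) (y t))).

Record parameter : Type := mk_parameter {
  y10 : R;
  dy20 : R;
  df0 : R;
  m1 : R;
  m2 : R
}.

Definition admissible (q : parameter) : Prop :=
  0 < y10 q /\ 0 < m1 q /\ 0 < m2 q.

Definition c1 (q : parameter) : R := y10 q * dy20 q.

Definition c2 (q : parameter) : R :=
  m2 q * dy20 q ^ 2
  - m2 q / (2 * y10 q) * (4 * m1 q + m2 q)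
  + m1 q / (4 * m2 q) * (m1 q + 2 * m2 q) * df0 q ^ 2.

Definition trajectory : Type := ((R -> R3) * (R -> R3) * (R -> R3))%type.

Definition solution_with_parameter (q : parameter) (s : trajectory) : Prop :=
  let '(x, y, z) := s in
  exists vx vy vz : R -> R3,
    three_body_solution (m1 q) (m2 q) x y z vx vy vz /\
    x 0 = vec3 0 0 0 /\
    y 0 = vec3 (y10 q) 0 0 /\
    z 0 = vec3 (- y10 q) 0 0 /\
    vx 0 = vec3 0 0 (df0 q) /\
    vy 0 = vec3 0 (dy20 q) (- (m1 q * df0 q / (2 * m2 q))) /\
    vz 0 = vec3 0 (- dy20 q) (- (m1 q * df0 q / (2 * m2 q))).

Definition family_L (q : parameter) (s : trajectory) : Prop :=
  admissible q /\ solution_with_parameter q s /\ c2 q < 0 /\ c1 q <> 0.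

Definition family_B (q : parameter) (s : trajectory) : Prop :=
  family_L q s /\
  8 * m1 q * m2 q ^ 2 + m2 q ^ 3 + 16 * c2 q * c1 q ^ 2 < 0.

Definition periodic (s : trajectory) : Prop :=
  let '(x, y, z) := s in
  exists T : R, 0 < T /\
    forall t : R, x (t + T) = x t /\ y (t + T) = y t /\ z (t + T) = z t.

Definition nontrivial (s : trajectory) : Prop :=
  let '(x, y, z) := s in ~ (forall t : R, x t = vec3 0 0 0).

(* Main.v *)
Require Import Defs.
From Stdlib Require Import Reals Ensembles Finite_sets Lra Lia Psatz FunctionalExtensionality ClassicalEpsilon.
From Coquelicot Require Import Coquelicot.
Open Scope R_scope.

(* Take c1 = 1, y10 = 1 and the polar angle theta as independent variable. With
   s = 1 / r, eps V = (x_3 - y_3) / r, m2 = kappa, m1 = k - kappa / 4 and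
   Q = (1 + (eps V)^2)^(-3/2), the motion is
     s'' = - s + m1 Q + kappa / 4,   V'' = - V - (kappa / s) (2 Q - 1/4) V,
   with s(0) = 1, s'(0) = V(0) = 0, V'(0) = 1. If also s'(pi/2) = V(pi/2) = 0, the
   reversibility theta -> - theta makes s and V pi-periodic in theta, so that the
   spatial motion closes up after one turn.
   Since (s' sin - s cos)' = (s'' + s) sin and 1 - Q = O(eps^2), one has
   s'(pi/2) = k - 1 + O(eps^2), with an error that is also O(eps^2)-Lipschitz in
   (k, kappa); hence s'(pi/2) = 0 defines k as a Lipschitz function of kappa. For
   eps = 0 and k = 1 the solution is s = 1, V = sin(omega theta) / omega with
   omega^2 = 1 + 7 kappa / 4, and V(pi/2) changes sign as omega passes 2, between
   kappa = 8/7 (omega = sqrt 3) and kappa = 16/7 (omega = sqrt 5). The intermediate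
   value theorem in kappa then gives a solution for every small eps > 0, and
   different eps give different initial velocities of x. *)

(** * Ordinary differential equations with bounded Lipschitz right-hand side *)

(** Sup-norm distance phrased as a bound, so that [J] needs neither finiteness nor an enumeration.
    For empty [J] it holds even with negative [d]; hence the auxiliary facts of the form [J -> ...]
    in the proofs below. *)
Definition coord_close {J : Type} (d : R) (x y : J -> R) : Prop :=
  forall i, Rabs (x i - y i) <= d.

Definition bounded_lipschitz {J : Type} (M L : R) (F : (J -> R) -> J -> R) : Prop :=
  (forall x i, Rabs (F x i) <= M) /\
  (forall x y d, coord_close d x y -> coord_close (L * d) (F x) (F y)).

Definition ode_solution {J : Type} (F : (J -> R) -> J -> R) (phi : R -> J -> R) : Prop :=
  forall t i, is_derive (fun s => phi s i) t (F (phi t) i).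

Lemma derive_nonneg_le (h dh : R -> R) (a b : R) :
  a <= b ->
  (forall s, a <= s <= b -> is_derive h s (dh s)) ->
  (forall s, a <= s <= b -> 0 <= dh s) ->
  h a <= h b.
Proof.
intros Hab Hd Hp.
destruct (MVT_gen h a b dh) as [c [Hc E]].
- intros s Hs. rewrite Rmin_left, Rmax_right in Hs by lra. apply Hd; lra.
- intros s Hs. rewrite Rmin_left, Rmax_right in Hs by lra.
  apply derivable_continuous_pt. exists (dh s). apply is_derive_Reals, Hd; lra.
- rewrite Rmin_left, Rmax_right in Hc by lra.
  assert (0 <= dh c * (b - a)) by (apply Rmult_le_pos; [apply Hp|]; lra). lra.
Qed.

(** Both [G - g] and [G + g] have nonnegative derivative. *)
Lemma derive_abs_le (g dg G dG : R -> R) (a b : R) :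
  a <= b ->
  (forall s, a <= s <= b -> is_derive g s (dg s)) ->
  (forall s, a <= s <= b -> is_derive G s (dG s)) ->
  (forall s, a <= s <= b -> Rabs (dg s) <= dG s) ->
  Rabs (g b - g a) <= G b - G a.
Proof.
intros Hab Hg HG Hle.
assert (H1 : G a - g a <= G b - g b).
{ apply (derive_nonneg_le (fun s => G s - g s) (fun s => dG s - dg s)); auto.
  - intros s Hs. apply (is_derive_minus G g); auto.
  - intros s Hs. specialize (Hle s Hs). apply Rabs_le_between in Hle. lra. }
assert (H2 : G a + g a <= G b + g b).
{ apply (derive_nonneg_le (fun s => G s + g s) (fun s => dG s + dg s)); auto.
  - intros s Hs. apply (is_derive_plus G g); auto.
  - intros s Hs. specialize (Hle s Hs). apply Rabs_le_between in Hle. lra. }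
apply Rabs_le; lra.
Qed.

Lemma is_derive_reflect (g : R -> R) (a t l : R) :
  is_derive g (a - t) l -> is_derive (fun s => g (a - s)) t (- l).
Proof.
intros H.
replace (- l) with (scal (-1) l) by (unfold scal; simpl; unfold mult; simpl; ring).
apply (is_derive_comp g (fun s => a - s)); [exact H|].
auto_derive; [exact I | ring].
Qed.

(** Comparison with [B * exp (c * s)] for nonnegative times, and reflection for negative ones.
    Integrating the exponential divides by [c]; with [c = 2 * L] a Lipschitz constant [L] becomes
    the factor 1/2 that drives the iterations below. *)
Lemma exp_majorant (g dg : R -> R) (B c : R) :
  (forall s, is_derive g s (dg s)) ->
  (forall s, Rabs (dg s) <= B * c * exp (c * Rabs s)) ->
  forall t, Rabs (g t - g 0) <= B * (exp (c * Rabs t) - 1).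
Proof.
assert (Hpos : forall g dg : R -> R,
  (forall s, is_derive g s (dg s)) ->
  (forall s, Rabs (dg s) <= B * c * exp (c * Rabs s)) ->
  forall t, 0 <= t -> Rabs (g t - g 0) <= B * (exp (c * t) - 1)).
{ clear g dg. intros g dg Hd Hb t Ht.
  replace (B * (exp (c * t) - 1)) with (B * exp (c * t) - B * exp (c * 0))
    by (rewrite Rmult_0_r, exp_0; ring).
  apply (derive_abs_le g dg (fun s => B * exp (c * s)) (fun s => B * c * exp (c * s))); auto.
  - intros s _. auto_derive; [exact I | ring].
  - intros s Hs. specialize (Hb s). rewrite (Rabs_pos_eq s) in Hb by lra. exact Hb. }
intros Hd Hb t. destruct (Rle_dec 0 t) as [Ht | Ht].
- rewrite (Rabs_pos_eq t) by lra. eapply Hpos; eauto.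
- rewrite (Rabs_left t) by lra.
  generalize (Hpos (fun s => g (0 - s)) (fun s => - dg (0 - s))).
  intros H. specialize (H (fun s => is_derive_reflect g 0 s _ (Hd _))).
  assert (Hb' : forall s, Rabs (- dg (0 - s)) <= B * c * exp (c * Rabs s)).
  { intros s. rewrite Rabs_Ropp. replace (Rabs s) with (Rabs (0 - s)); [apply Hb|].
    rewrite <- (Rabs_Ropp s). f_equal. ring. }
  specialize (H Hb' (- t)). cbv beta in H.
  replace (0 - - t) with t in H by ring. replace (0 - 0) with 0 in H by ring.
  apply H; lra.
Qed.

Lemma exp_abs_ge_1 (c t : R) : 0 <= c -> 1 <= exp (c * Rabs t).
Proof.
intros Hc. rewrite <- exp_0. assert (0 <= c * Rabs t) by (apply Rmult_le_pos; [lra | apply Rabs_pos]).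
destruct (Req_dec (c * Rabs t) 0) as [E | E]; [rewrite E; lra|].
left. apply exp_increasing. lra.
Qed.

Lemma half_pow_pos (k : nat) : 0 < (/ 2) ^ k.
Proof. apply pow_lt; lra. Qed.

Lemma le_of_geometric (a b A : R) :
  (forall k : nat, a <= b + A * (/ 2) ^ k) -> a <= b.
Proof.
intros H.
assert (Hl : is_lim_seq (fun k => b + A * (/ 2) ^ k) (b + A * 0)).
{ apply (is_lim_seq_plus' (fun _ => b)); [apply is_lim_seq_const|].
  apply (is_lim_seq_scal_l _ A 0), is_lim_seq_geom. rewrite Rabs_pos_eq; lra. }
generalize (is_lim_seq_le (fun _ => a) _ a _ H (is_lim_seq_const a) Hl). simpl. lra.
Qed.

Lemma geometric_cauchy (u : nat -> R) (A : R) :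
  (forall k, Rabs (u (S k) - u k) <= A * (/ 2) ^ k) ->
  exists l, forall k, Rabs (l - u k) <= 2 * A * (/ 2) ^ k.
Proof.
intros H.
assert (HA : 0 <= A).
{ generalize (H O) (Rabs_pos (u 1%nat - u O)). simpl. lra. }
(* Keeping the exact geometric sum, with its factor [1 - (/ 2) ^ m], is what lets the induction on
   [m] close. *)
assert (Hm : forall k m, Rabs (u (k + m)%nat - u k) <= 2 * A * (/ 2) ^ k * (1 - (/ 2) ^ m)).
{ intros k m. induction m as [|m IH].
  - rewrite Nat.add_0_r. unfold Rminus. rewrite Rplus_opp_r, Rabs_R0. simpl. lra.
  - rewrite Nat.add_succ_r.
    replace (u (S (k + m)) - u k) with ((u (S (k + m)) - u (k + m)%nat) + (u (k + m)%nat - u k)) by ring.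
    eapply Rle_trans; [apply Rabs_triang|]. specialize (H (k + m)%nat).
    rewrite pow_add in H. simpl pow. lra. }
assert (Hb : forall k m, Rabs (u (k + m)%nat - u k) <= 2 * A * (/ 2) ^ k).
{ intros k m. eapply Rle_trans; [apply Hm|].
  assert (0 <= 2 * A * (/ 2) ^ k * (/ 2) ^ m); [|lra].
  generalize (half_pow_pos k) (half_pow_pos m). intros. repeat apply Rmult_le_pos; lra. }
assert (Hl : exists l : R, is_lim_seq u l).
{ apply ex_lim_seq_cauchy_corr. intros eps.
  assert (Hg : is_lim_seq (fun k => 4 * A * (/ 2) ^ k) (4 * A * 0)).
  { apply (is_lim_seq_scal_l _ (4 * A) 0), is_lim_seq_geom. rewrite Rabs_pos_eq; lra. }
  apply is_lim_seq_spec in Hg. destruct (Hg eps) as [N HN].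
  exists N. intros n m Hn Hm'.
  specialize (HN N (Nat.le_refl N)). rewrite Rmult_0_r, Rminus_0_r in HN.
  apply Rabs_lt_between in HN.
  generalize (Hb N (n - N)%nat) (Hb N (m - N)%nat).
  replace (N + (n - N))%nat with n by lia. replace (N + (m - N))%nat with m by lia.
  intros H1 H2. apply Rabs_le_between in H1. apply Rabs_le_between in H2.
  apply Rabs_lt_between. lra. }
destruct Hl as [l Hl]. exists l. intros k.
assert (Hk : is_lim_seq (fun m => Rabs (u (m + k)%nat - u k)) (Rabs (l - u k))).
{ apply (is_lim_seq_abs _ (l - u k)).
  apply (is_lim_seq_minus' _ (fun _ => u k)); [|apply is_lim_seq_const].
  apply is_lim_seq_incr_n. exact Hl. }
apply (is_lim_seq_le _ (fun _ => 2 * A * (/ 2) ^ k) _ _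
         (fun m => eq_ind _ (fun n => Rabs (u n - u k) <= _) (Hb k m) _ (Nat.add_comm k m))
         Hk (is_lim_seq_const _)).
Qed.

Lemma lipschitz_continuous (g : R -> R) (K : R) :
  (forall s t, Rabs (g s - g t) <= K * Rabs (s - t)) -> forall t, continuous g t.
Proof.
intros H t. apply continuity_pt_filterlim.
intros eps Heps.
assert (HK : 0 <= K).
{ generalize (H 1 0) (Rabs_pos (g 1 - g 0)). rewrite Rminus_0_r, Rabs_R1. lra. }
(* [K + 1] rather than [K], since [K] may be 0. *)
exists (eps / (K + 1)). split; [apply Rdiv_lt_0_compat; lra|].
intros s [_ Hs]. simpl in *. unfold Rdist in *.
eapply Rle_lt_trans; [apply H|].
apply Rle_lt_trans with ((K + 1) * Rabs (s - t)).
- generalize (Rabs_pos (s - t)). nra.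
- apply (Rmult_lt_compat_l (K + 1)) in Hs; [|lra].
  replace ((K + 1) * (eps / (K + 1))) with eps in Hs by (field; lra). exact Hs.
Qed.

Lemma bounded_derive_lipschitz (g dg : R -> R) (K : R) :
  (forall s, is_derive g s (dg s)) -> (forall s, Rabs (dg s) <= K) ->
  forall s t, Rabs (g s - g t) <= K * Rabs (s - t).
Proof.
intros Hd Hb.
assert (H : forall s t, t <= s -> Rabs (g s - g t) <= K * (s - t)).
{ intros s t Hst. rewrite Rmult_minus_distr_l.
  apply (derive_abs_le g dg (fun s => K * s) (fun _ => K)); auto.
  intros r _. auto_derive; [exact I | ring]. }
intros s t. destruct (Rle_dec t s) as [Hst | Hst].
- rewrite (Rabs_pos_eq (s - t)) by lra. auto.
- rewrite Rabs_minus_sym, (Rabs_minus_sym s), (Rabs_pos_eq (t - s)) by lra. apply H; lra.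
Qed.

(** Along an [M]-Lipschitz curve the integrand is [L * M]-Lipschitz, hence continuous, and the
    fundamental theorem of calculus applies. *)
Lemma primitive_exists {J : Type} (M L : R) (F : (J -> R) -> J -> R) (phi : R -> J -> R) :
  bounded_lipschitz M L F ->
  (forall s t, coord_close (M * Rabs (s - t)) (phi s) (phi t)) ->
  forall i t, is_derive (fun r => RInt (fun s => F (phi s) i) 0 r) t (F (phi t) i).
Proof.
intros [_ HL] Hphi i t.
assert (Hc : forall t, continuous (fun s => F (phi s) i) t).
{ apply (lipschitz_continuous _ (L * M)). intros r s. rewrite Rmult_assoc.
  apply (HL (phi r) (phi s)), Hphi. }
apply (is_derive_RInt (fun s => F (phi s) i) _ 0); [|apply Hc].
apply filter_forall. intros r. apply (RInt_correct (V := R_CompleteNormedModule)).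
apply (ex_RInt_continuous (V := R_CompleteNormedModule)). intros; apply Hc.
Qed.

(** * Picard iteration, global existence and uniqueness *)

Fixpoint picard {J : Type} (F : (J -> R) -> J -> R) (x0 : J -> R) (k : nat) (t : R) (i : J) : R :=
  match k with
  | O => x0 i
  | S k => x0 i + RInt (fun s => F (picard F x0 k s) i) 0 t
  end.

Lemma picard_lipschitz {J : Type} (M L : R) (F : (J -> R) -> J -> R) (x0 : J -> R) (k : nat) :
  bounded_lipschitz M L F ->
  forall s t, coord_close (M * Rabs (s - t)) (picard F x0 k s) (picard F x0 k t).
Proof.
intros HF. induction k as [|k IH]; intros s t i.
- simpl. rewrite Rminus_diag, Rabs_R0. apply Rmult_le_pos; [|apply Rabs_pos].
  destruct HF as [HM _]. eapply Rle_trans; [apply Rabs_pos | apply (HM x0 i)].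
- apply (bounded_derive_lipschitz (fun t => picard F x0 (S k) t i)
           (fun t => F (picard F x0 k t) i)).
  + intros r. simpl. evar_last.
    * apply @is_derive_plus; [apply is_derive_const | eapply primitive_exists; eauto].
    * apply plus_zero_l.
  + intros r. apply HF.
Qed.

Lemma picard_derive {J : Type} (M L : R) (F : (J -> R) -> J -> R) (x0 : J -> R) (k : nat) (t : R) (i : J) :
  bounded_lipschitz M L F ->
  is_derive (fun s => picard F x0 (S k) s i) t (F (picard F x0 k t) i).
Proof.
intros HF. simpl. evar_last.
- apply @is_derive_plus; [apply is_derive_const |].
  eapply primitive_exists; [eauto | apply (picard_lipschitz M L); exact HF].
- apply plus_zero_l.
Qed.

Lemma picard_0 {J : Type} (F : (J -> R) -> J -> R) (x0 : J -> R) (k : nat) (i : J) :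
  picard F x0 k 0 i = x0 i.
Proof.
destruct k; simpl; [reflexivity|]. rewrite RInt_point. apply Rplus_0_r.
Qed.

(** In the norm weighted by [exp (2 * L * Rabs t)] the Picard map contracts by 1/2 on the whole
    line, so no local solutions have to be glued. The initial constant is [M / (2 * L)] because the
    first step has derivative at most [M]. *)
Lemma picard_step {J : Type} (M L : R) (F : (J -> R) -> J -> R) (x0 : J -> R) :
  0 < L -> bounded_lipschitz M L F ->
  forall k t, coord_close (M / (2 * L) * (/ 2) ^ k * exp (2 * L * Rabs t))
                    (picard F x0 (S k) t) (picard F x0 k t).
Proof.
intros HL0 HF k.
assert (HM : J -> 0 <= M).
{ intros i. destruct HF as [HM _]. eapply Rle_trans; [apply Rabs_pos | apply (HM x0 i)]. }
assert (HB : J -> 0 <= M / (2 * L)).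
{ intros i. apply Rmult_le_pos; [exact (HM i)|]. left. apply Rinv_0_lt_compat. lra. }
assert (step : forall k t i dg,
  (forall s, is_derive (fun s => picard F x0 (S k) s i - picard F x0 k s i) s (dg s)) ->
  (forall s, Rabs (dg s) <= M / (2 * L) * (/ 2) ^ k * (2 * L) * exp (2 * L * Rabs s)) ->
  Rabs (picard F x0 (S k) t i - picard F x0 k t i)
    <= M / (2 * L) * (/ 2) ^ k * exp (2 * L * Rabs t)).
{ clear k. intros k t i dg Hd Hb.
  generalize (exp_majorant _ _ _ _ Hd Hb t). cbv beta. rewrite !picard_0.
  rewrite Rminus_diag, Rminus_0_r. intros H. eapply Rle_trans; [exact H|].
  assert (0 <= M / (2 * L) * (/ 2) ^ k).
  { apply Rmult_le_pos; [exact (HB i) | left; apply half_pow_pos]. }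
  lra. }
induction k as [|k IH]; intros t i.
- apply (step O t i (fun s => F (picard F x0 O s) i)).
  + intros s. evar_last.
    * apply (is_derive_minus (fun s => picard F x0 1 s i) (fun _ => x0 i)).
      -- apply (picard_derive M L); exact HF.
      -- apply is_derive_const.
    * unfold minus, plus, opp, zero; simpl; ring.
  + intros s. destruct HF as [Hb _]. eapply Rle_trans; [apply Hb|]. simpl pow.
    replace (M / (2 * L) * 1 * (2 * L)) with M by (field; lra).
    generalize (exp_abs_ge_1 (2 * L) s) (HM i). intros. nra.
- apply (step (S k) t i (fun s => F (picard F x0 (S k) s) i - F (picard F x0 k s) i)).
  + intros s.
    apply (is_derive_minus (fun s => picard F x0 (S (S k)) s i) (fun s => picard F x0 (S k) s i));
      apply (picard_derive M L); exact HF.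
  + intros s. destruct HF as [_ HL]. eapply Rle_trans; [apply (HL _ _ _ (IH s))|].
    simpl pow. apply Req_le. field. lra.
Qed.

(** The iterates converge pointwise at a geometric rate. Their limit inherits the [M]-Lipschitz
    bound, so its right-hand side can be integrated, and the resulting integral is the limit of the
    next iterates, that is, the limit itself. *)
Lemma ode_exists {J : Type} (M L : R) (F : (J -> R) -> J -> R) (x0 : J -> R) :
  0 < L -> bounded_lipschitz M L F ->
  exists phi, ode_solution F phi /\ forall i, phi 0 i = x0 i.
Proof.
intros HL0 HF.
pose (B := M / (2 * L)).
assert (Hlim : forall t i, exists l, forall k,
  Rabs (l - picard F x0 k t i) <= 2 * (B * exp (2 * L * Rabs t)) * (/ 2) ^ k).
{ intros t i. apply geometric_cauchy. intros k.
  eapply Rle_trans; [apply (picard_step M L F x0 HL0 HF)|]. apply Req_le. unfold B. ring. }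
pose (phi t i := proj1_sig (constructive_indefinite_description _ (Hlim t i))).
assert (Hphi : forall k t, coord_close (2 * (B * exp (2 * L * Rabs t)) * (/ 2) ^ k)
                                 (phi t) (picard F x0 k t)).
{ intros k t i. unfold phi.
  destruct (constructive_indefinite_description _ (Hlim t i)) as [l Hl]. apply Hl. }
assert (Hlip : forall s t, coord_close (M * Rabs (s - t)) (phi s) (phi t)).
{ intros s t i.
  apply (le_of_geometric _ _ (2 * (B * exp (2 * L * Rabs s)) + 2 * (B * exp (2 * L * Rabs t)))).
  intros k. generalize (Hphi k s i) (Hphi k t i) (picard_lipschitz M L F x0 k HF s t i).
  intros H1 H2 H3. apply Rabs_le_between in H1. apply Rabs_le_between in H2.
  apply Rabs_le_between in H3. apply Rabs_le. lra. }
assert (Hder : forall i t,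
  is_derive (fun t => x0 i + RInt (fun s => F (phi s) i) 0 t) t (F (phi t) i)).
{ intros i t. evar_last.
  - apply @is_derive_plus; [apply is_derive_const | eapply primitive_exists; eauto].
  - apply plus_zero_l. }
assert (Heq : forall t i, x0 i + RInt (fun s => F (phi s) i) 0 t = phi t i).
{ intros t i.
  assert (H : Rabs (x0 i + RInt (fun s => F (phi s) i) 0 t - phi t i) <= 0).
  { apply (le_of_geometric _ _ (4 * (B * exp (2 * L * Rabs t)))). intros k.
    assert (H1 : Rabs (x0 i + RInt (fun s => F (phi s) i) 0 t - picard F x0 (S k) t i)
                 <= B * (/ 2) ^ k * (exp (2 * L * Rabs t) - 1)).
    { generalize (exp_majorant
        (fun t => x0 i + RInt (fun s => F (phi s) i) 0 t - picard F x0 (S k) t i)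
        (fun t => F (phi t) i - F (picard F x0 k t) i) (B * (/ 2) ^ k) (2 * L)).
      intros H. cbv beta in H. rewrite picard_0, RInt_point in H.
      unfold zero in H; simpl in H. rewrite Rplus_0_r, Rminus_diag in H.
      specialize (fun a b => H a b t). rewrite Rminus_0_r in H. apply H; clear H.
      - intros s. apply (is_derive_minus (fun t => x0 i + RInt (fun s => F (phi s) i) 0 t)
                                         (fun t => picard F x0 (S k) t i)).
        + apply Hder.
        + apply (picard_derive M L); exact HF.
      - intros s. destruct HF as [_ HL]. eapply Rle_trans; [apply (HL _ _ _ (Hphi k s))|].
        apply Req_le. ring. }
    generalize (Hphi (S k) t i). intros H2. simpl pow in H2.
    assert (0 <= B * (/ 2) ^ k).
    { unfold B. destruct HF as [HM _].
      assert (0 <= M) by (eapply Rle_trans; [apply Rabs_pos | apply (HM x0 i)]).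
      apply Rmult_le_pos; [apply Rmult_le_pos; [lra | left; apply Rinv_0_lt_compat; lra]
                          | left; apply half_pow_pos]. }
    assert (H3 : 0 <= B * (/ 2) ^ k * exp (2 * L * Rabs t))
      by (apply Rmult_le_pos; [lra | left; apply exp_pos]).
    apply Rabs_le_between in H1. apply Rabs_le_between in H2. apply Rabs_le. lra. }
  generalize (Rabs_pos (x0 i + RInt (fun s => F (phi s) i) 0 t - phi t i)). intros H0.
  destruct (Req_dec (x0 i + RInt (fun s => F (phi s) i) 0 t - phi t i) 0) as [E | E]; [lra|].
  apply Rabs_pos_lt in E. lra. }
exists phi. split.
- intros t i. apply (is_derive_ext _ _ _ _ (fun t => Heq t i)), Hder.
- intros i. rewrite <- Heq, RInt_point. apply Rplus_0_r.
Qed.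

(** Boundedness of [F] gives the crude bound with [d + M / L]. Feeding a bound back into the
    equation halves the excess over [d], and letting [k] tend to infinity removes it. *)
Lemma ode_gronwall {J : Type} (M L : R) (F : (J -> R) -> J -> R) (a b : R -> J -> R) (d : R) :
  0 < L -> bounded_lipschitz M L F -> ode_solution F a -> ode_solution F b ->
  coord_close d (a 0) (b 0) ->
  forall t, coord_close (d * exp (2 * L * Rabs t)) (a t) (b t).
Proof.
intros HL0 [HM HL] Ha Hb Hd.
assert (HD : forall i s, is_derive (fun s => a s i - b s i) s (F (a s) i - F (b s) i)).
{ intros i s. apply (is_derive_minus (fun s => a s i) (fun s => b s i)); [apply Ha | apply Hb]. }
assert (HC : J -> 0 <= M / L).
{ intros i. apply Rmult_le_pos; [|left; apply Rinv_0_lt_compat; lra].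
  eapply Rle_trans; [apply Rabs_pos | apply (HM (a 0) i)]. }
assert (Hd0 : J -> 0 <= d).
{ intros i. eapply Rle_trans; [apply Rabs_pos | apply (Hd i)]. }
assert (Hk : forall k t, coord_close ((d + M / L * (/ 2) ^ k) * exp (2 * L * Rabs t)) (a t) (b t)).
{ intros k. induction k as [|k IH]; intros t i.
  - assert (H : Rabs ((a t i - b t i) - (a 0 i - b 0 i)) <= M / L * (exp (2 * L * Rabs t) - 1)).
    { apply (exp_majorant _ _ _ _ (HD i)). intros s.
      replace (M / L * (2 * L)) with (M + M) by (field; lra).
      generalize (HM (a s) i) (HM (b s) i) (exp_abs_ge_1 (2 * L) s). intros H1 H2 H3.
      apply Rle_trans with ((M + M) * 1).
      - apply Rabs_le_between in H1. apply Rabs_le_between in H2. apply Rabs_le; lra.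
      - apply Rmult_le_compat_l; [|apply H3; lra]. generalize (Rabs_pos (F (a s) i)); lra. }
    generalize (Hd i) (HC i) (Hd0 i) (exp_abs_ge_1 (2 * L) t ltac:(lra)). intros H1 H2 H3 H4.
    apply Rabs_le_between in H. apply Rabs_le_between in H1. simpl pow. apply Rabs_le. nra.
  - assert (H : Rabs ((a t i - b t i) - (a 0 i - b 0 i))
                <= (d + M / L * (/ 2) ^ k) / 2 * (exp (2 * L * Rabs t) - 1)).
    { apply (exp_majorant _ _ _ _ (HD i)). intros s.
      eapply Rle_trans; [apply (HL _ _ _ (IH s))|]. apply Req_le. field. lra. }
    generalize (Hd i) (HC i) (Hd0 i) (exp_abs_ge_1 (2 * L) t ltac:(lra)) (half_pow_pos k).
    intros H1 H2 H3 H4 H5.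
    assert (0 <= M / L * (/ 2) ^ k) by (apply Rmult_le_pos; lra).
    apply Rabs_le_between in H. apply Rabs_le_between in H1. simpl pow. apply Rabs_le. nra. }
intros t i. apply (le_of_geometric _ _ (M / L * exp (2 * L * Rabs t))). intros k.
eapply Rle_trans; [apply (Hk k)|]. apply Req_le. ring.
Qed.

Lemma ode_unique {J : Type} (M L : R) (F : (J -> R) -> J -> R) (a b : R -> J -> R) :
  0 < L -> bounded_lipschitz M L F -> ode_solution F a -> ode_solution F b ->
  (forall i, a 0 i = b 0 i) -> forall t i, a t i = b t i.
Proof.
intros HL HF Ha Hb H0 t i.
assert (H : coord_close 0 (a 0) (b 0)).
{ intros j. rewrite H0, Rminus_diag, Rabs_R0. lra. }
generalize (ode_gronwall M L F a b 0 HL HF Ha Hb H t i). rewrite Rmult_0_l.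
intros H1. apply Rabs_le_between in H1. lra.
Qed.

(** * The reduced system *)

(** The constants are existential: only their existence matters, and the closure lemmas then replace
    explicit estimates of the vector field. Boundedness is included because products need it. *)
Definition scalar_bl {J : Type} (g : (J -> R) -> R) : Prop :=
  exists M L, (forall x, Rabs (g x) <= M) /\
    forall x y d, coord_close d x y -> Rabs (g x - g y) <= L * d.

Lemma scalar_bl_const {J : Type} (c : R) : scalar_bl (fun _ : J -> R => c).
Proof.
exists (Rabs c), 0. split; intros; [lra|]. rewrite Rminus_diag, Rabs_R0. lra.
Qed.

Lemma scalar_bl_plus {J : Type} (f g : (J -> R) -> R) :
  scalar_bl f -> scalar_bl g -> scalar_bl (fun x => f x + g x).
Proof.
intros [M [L [HM HL]]] [M' [L' [HM' HL']]]. exists (M + M'), (L + L'). split.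
- intros x. eapply Rle_trans; [apply Rabs_triang|]. specialize (HM x). specialize (HM' x). lra.
- intros x y d H. specialize (HL x y d H). specialize (HL' x y d H).
  replace (f x + g x - (f y + g y)) with ((f x - f y) + (g x - g y)) by ring.
  eapply Rle_trans; [apply Rabs_triang|]. lra.
Qed.

Lemma scalar_bl_mult {J : Type} (f g : (J -> R) -> R) :
  scalar_bl f -> scalar_bl g -> scalar_bl (fun x => f x * g x).
Proof.
intros [M [L [HM HL]]] [M' [L' [HM' HL']]]. exists (M * M'), (L * M' + M * L'). split.
- intros x. rewrite Rabs_mult. apply Rmult_le_compat; auto using Rabs_pos.
- intros x y d H. specialize (HL x y d H). specialize (HL' x y d H).
  replace (f x * g x - f y * g y) with ((f x - f y) * g x + f y * (g x - g y)) by ring.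
  eapply Rle_trans; [apply Rabs_triang|]. rewrite !Rabs_mult.
  apply Rle_trans with (L * d * M' + M * (L' * d)); [|lra].
  apply Rplus_le_compat; apply Rmult_le_compat; auto using Rabs_pos.
Qed.

Lemma scalar_bl_opp {J : Type} (f : (J -> R) -> R) :
  scalar_bl f -> scalar_bl (fun x => - f x).
Proof.
intros [M [L [HM HL]]]. exists M, L. split.
- intros x. rewrite Rabs_Ropp. auto.
- intros x y d H. replace (- f x - - f y) with (- (f x - f y)) by ring.
  rewrite Rabs_Ropp. auto.
Qed.

Lemma scalar_bl_minus {J : Type} (f g : (J -> R) -> R) :
  scalar_bl f -> scalar_bl g -> scalar_bl (fun x => f x - g x).
Proof. intros Hf Hg. apply scalar_bl_plus, scalar_bl_opp; assumption. Qed.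

Lemma scalar_bl_pow {J : Type} (f : (J -> R) -> R) (n : nat) :
  scalar_bl f -> scalar_bl (fun x => f x ^ n).
Proof.
intros Hf. induction n; simpl; [apply scalar_bl_const | apply scalar_bl_mult; assumption].
Qed.

Lemma scalar_bl_inv {J : Type} (m : R) (f : (J -> R) -> R) :
  0 < m -> (forall x, m <= f x) -> scalar_bl f -> scalar_bl (fun x => / f x).
Proof.
intros Hm Hf [M [L [HM HL]]].
assert (Hi : forall x, Rabs (/ f x) <= / m).
{ intros x. specialize (Hf x). rewrite Rabs_pos_eq by (left; apply Rinv_0_lt_compat; lra).
  apply Rinv_le_contravar; lra. }
exists (/ m), (/ m * L * / m). split; [exact Hi|].
intros x y d H.
replace (/ f x - / f y) with (/ f x * (- (f x - f y)) * / f y)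
  by (generalize (Hf x) (Hf y); intros; field; lra).
rewrite !Rabs_mult, Rabs_Ropp.
replace (/ m * L * / m * d) with (/ m * (L * d) * / m) by ring.
apply Rmult_le_compat; auto using Rabs_pos, Rmult_le_pos.
apply Rmult_le_compat; auto using Rabs_pos.
Qed.

(** On values at least 1 the root is dominated by its argument and is 1-Lipschitz, the difference of
    roots being the difference of arguments divided by the sum of the roots. *)
Lemma scalar_bl_sqrt {J : Type} (f : (J -> R) -> R) :
  (forall x, 1 <= f x) -> scalar_bl f -> scalar_bl (fun x => sqrt (f x)).
Proof.
intros Hf [M [L [HM HL]]].
assert (H1 : forall x, 1 <= sqrt (f x)).
{ intros x. rewrite <- sqrt_1. apply sqrt_le_1_alt, Hf. }
assert (H2 : forall x, sqrt (f x) * sqrt (f x) = f x).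
{ intros x. apply sqrt_sqrt. specialize (Hf x). lra. }
exists M, L. split.
- intros x. specialize (HM x). rewrite (Rabs_pos_eq (f x)) in HM by (specialize (Hf x); lra).
  rewrite Rabs_pos_eq by (specialize (H1 x); lra).
  specialize (H1 x). specialize (H2 x). nra.
- intros x y d H. specialize (HL x y d H). eapply Rle_trans; [|exact HL].
  replace (f x - f y) with ((sqrt (f x) - sqrt (f y)) * (sqrt (f x) + sqrt (f y)))
    by (rewrite <- (H2 x) at 3; rewrite <- (H2 y) at 3; ring).
  rewrite Rabs_mult, (Rabs_pos_eq (_ + _)) by (generalize (H1 x) (H1 y); lra).
  generalize (Rabs_pos (sqrt (f x) - sqrt (f y))) (H1 x) (H1 y). nra.
Qed.

(** * Truncation to a box and the truncated vector field *)

Definition clamp (a b x : R) : R := Rmax a (Rmin b x).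

Lemma clamp_between (a b x : R) : a <= b -> a <= clamp a b x <= b.
Proof.
intros H. unfold clamp. split; [apply Rmax_l|].
apply Rmax_lub; [exact H | apply Rmin_l].
Qed.

Lemma clamp_id (a b x : R) : a <= x <= b -> clamp a b x = x.
Proof. intros H. unfold clamp. rewrite Rmin_right, Rmax_right; lra. Qed.

Lemma clamp_lipschitz (a b x y : R) : Rabs (clamp a b x - clamp a b y) <= Rabs (x - y).
Proof.
unfold clamp, Rmax, Rmin.
repeat destruct Rle_dec; unfold Rabs; repeat destruct Rcase_abs; lra.
Qed.

Lemma clamp_opp (a x : R) : 0 <= a -> clamp (- a) a (- x) = - clamp (- a) a x.
Proof. intros Ha. unfold clamp, Rmax, Rmin. repeat destruct Rle_dec; lra. Qed.

Lemma clamp_abs_le (a b x : R) : a <= b -> Rabs (clamp a b x) <= Rabs a + Rabs b.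
Proof.
intros H. generalize (clamp_between a b x H). intros Hx.
unfold Rabs; repeat destruct Rcase_abs; lra.
Qed.

(* [inv_rad] is s, [height] is V and [energy_k] is k. The parameters are constant
   coordinates of the state, so that dependence on parameters is dependence on the
   initial state. *)
Inductive coord : Type :=
  inv_rad | d_inv_rad | height | d_height | energy_k | kappa | eps.

(** The box contains every circular orbit with [kappa] between 8/7 and 16/7, with a margin of 1/8 in
    each coordinate. It keeps s away from 0 and is symmetric in the coordinates whose sign the
    reversal changes. *)
Definition lower (i : coord) : R :=
  match i with
  | inv_rad => 1 / 2 | energy_k => 1 / 2 | kappa => 1 | eps => - (1) | _ => - (2)
  end.

Definition upper (i : coord) : R :=
  match i with
  | inv_rad => 3 / 2 | energy_k => 3 / 2 | kappa => 3 | eps => 1 | _ => 2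
  end.

Lemma lower_le_upper (i : coord) : lower i <= upper i.
Proof. destruct i; simpl; lra. Qed.

Definition truncate (x : coord -> R) (i : coord) : R := clamp (lower i) (upper i) (x i).

Definition in_box (x : coord -> R) : Prop := forall i, lower i <= x i <= upper i.

Lemma truncate_in_box (x : coord -> R) : in_box (truncate x).
Proof. intros i. apply clamp_between, lower_le_upper. Qed.

Lemma truncate_id (x : coord -> R) : in_box x -> truncate x = x.
Proof. intros H. apply functional_extensionality. intros i. apply clamp_id, H. Qed.

Lemma scalar_bl_truncate (i : coord) : scalar_bl (fun x => truncate x i).
Proof.
exists (Rabs (lower i) + Rabs (upper i)), 1. split.
- intros x. apply clamp_abs_le, lower_le_upper.
- intros x y d H. eapply Rle_trans; [apply clamp_lipschitz|]. rewrite Rmult_1_l. apply H.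
Qed.

Definition dist_ratio (y : coord -> R) : R := sqrt (1 + (y eps * y height) ^ 2).

(* [m1 * (1 - Q) / eps^2], written without the division, where
   [Q = 1 / dist_ratio ^ 3]. *)
Definition planar_defect (y : coord -> R) : R :=
  (y energy_k - y kappa / 4) * y height ^ 2 *
  ((dist_ratio y ^ 2 + dist_ratio y + 1) * / (dist_ratio y ^ 3 * (dist_ratio y + 1))).

(** The equation for s'' is written with [energy_k] and [planar_defect], which displays the factor
    [eps ^ 2] that makes the shooting errors small; [planar_defect_spec] restores the physical
    form. *)
Definition field (y : coord -> R) (i : coord) : R :=
  match i with
  | inv_rad => y d_inv_rad
  | d_inv_rad => - y inv_rad + y energy_k - y eps ^ 2 * planar_defect y
  | height => y d_height
  | d_height => - y height - y kappa * / y inv_rad * (2 * / dist_ratio y ^ 3 - 1 / 4) * y height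
  | _ => 0
  end.

(** Truncating the argument makes the field bounded and Lipschitz on the whole space, so solutions
    are global; inside the box the equation is unchanged. *)
Definition clamped_field (x : coord -> R) : coord -> R := field (truncate x).

Lemma dist_ratio_ge_1 (y : coord -> R) : 1 <= dist_ratio y.
Proof.
unfold dist_ratio. rewrite <- sqrt_1 at 1. apply sqrt_le_1_alt.
generalize (pow2_ge_0 (y eps * y height)). lra.
Qed.

Lemma dist_ratio_sqr (y : coord -> R) : dist_ratio y ^ 2 = 1 + (y eps * y height) ^ 2.
Proof. unfold dist_ratio. apply pow2_sqrt. generalize (pow2_ge_0 (y eps * y height)). lra. Qed.

(** With D the distance ratio, [D ^ 2 - 1] is the square of eps V, and 1 - 1/D^3 = (D^2 - 1)(D^2 + D
    + 1) / (D^3 (D + 1)). *)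
Lemma planar_defect_spec (y : coord -> R) :
  y energy_k - y eps ^ 2 * planar_defect y
  = (y energy_k - y kappa / 4) * / dist_ratio y ^ 3 + y kappa / 4.
Proof.
unfold planar_defect. generalize (dist_ratio_sqr y) (dist_ratio_ge_1 y).
generalize (dist_ratio y). intros D HD H1.
assert (E : y eps ^ 2 * y height ^ 2 = D ^ 2 - 1) by (rewrite HD; ring).
replace (y eps ^ 2 * ((y energy_k - y kappa / 4) * y height ^ 2 *
   ((D ^ 2 + D + 1) * / (D ^ 3 * (D + 1)))))
 with ((y eps ^ 2 * y height ^ 2) * ((y energy_k - y kappa / 4) *
   ((D ^ 2 + D + 1) * / (D ^ 3 * (D + 1))))) by ring.
rewrite E. field. lra.
Qed.

Lemma scalar_bl_dist_ratio : scalar_bl (fun x => dist_ratio (truncate x)).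
Proof.
apply scalar_bl_sqrt.
- intros x. generalize (pow2_ge_0 (truncate x eps * truncate x height)). lra.
- apply scalar_bl_plus; [apply scalar_bl_const|].
  apply scalar_bl_pow, scalar_bl_mult; apply scalar_bl_truncate.
Qed.

Lemma scalar_bl_planar_defect : scalar_bl (fun x => planar_defect (truncate x)).
Proof.
apply scalar_bl_mult; [apply scalar_bl_mult|].
- apply scalar_bl_minus; [apply scalar_bl_truncate|].
  apply scalar_bl_mult; [apply scalar_bl_truncate | apply scalar_bl_const].
- apply scalar_bl_pow, scalar_bl_truncate.
- apply scalar_bl_mult.
  + repeat apply scalar_bl_plus; try apply scalar_bl_pow; try apply scalar_bl_const;
      apply scalar_bl_dist_ratio.
  + apply (scalar_bl_inv 1); [lra | | ].
    * intros x. generalize (dist_ratio_ge_1 (truncate x)). intros H.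
      assert (1 <= dist_ratio (truncate x) ^ 3) by (apply pow_R1_Rle; exact H). nra.
    * apply scalar_bl_mult; [apply scalar_bl_pow, scalar_bl_dist_ratio|].
      apply scalar_bl_plus; [apply scalar_bl_dist_ratio | apply scalar_bl_const].
Qed.

Lemma scalar_bl_field (i : coord) : scalar_bl (fun x => clamped_field x i).
Proof.
unfold clamped_field. destruct i; cbn [field];
  try apply scalar_bl_const; try apply scalar_bl_truncate.
- apply scalar_bl_minus; [apply scalar_bl_plus|].
  + apply scalar_bl_opp, scalar_bl_truncate.
  + apply scalar_bl_truncate.
  + apply scalar_bl_mult; [apply scalar_bl_pow, scalar_bl_truncate | apply scalar_bl_planar_defect].
- apply scalar_bl_minus; [apply scalar_bl_opp, scalar_bl_truncate|].
  apply scalar_bl_mult; [|apply scalar_bl_truncate].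
  apply scalar_bl_mult; [apply scalar_bl_mult|].
  + apply scalar_bl_truncate.
  + apply (scalar_bl_inv (1 / 2)); [lra| |apply scalar_bl_truncate].
    intros x. apply (truncate_in_box x inv_rad).
  + apply scalar_bl_minus; [|apply scalar_bl_const].
    apply scalar_bl_mult; [apply scalar_bl_const|].
    apply (scalar_bl_inv 1); [lra| |apply scalar_bl_pow, scalar_bl_dist_ratio].
    intros x. apply pow_R1_Rle, dist_ratio_ge_1.
Qed.

Lemma close_nonneg {J : Type} (i : J) (d : R) (x y : J -> R) : coord_close d x y -> 0 <= d.
Proof. intros H. eapply Rle_trans; [apply Rabs_pos | apply (H i)]. Qed.

(** There are seven coordinates, so common constants are maxima, collected by induction over a list
    of coordinates. *)
Lemma field_bounded_lipschitz : exists M L, 0 < L /\ bounded_lipschitz M L clamped_field.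
Proof.
assert (H : forall l : list coord, exists M L, 0 < L /\ forall i, List.In i l ->
  (forall x, Rabs (clamped_field x i) <= M) /\
  (forall x y d, coord_close d x y -> Rabs (clamped_field x i - clamped_field y i) <= L * d)).
{ induction l as [|j l IH].
  - exists 0, 1. split; [lra|]. intros i [].
  - destruct IH as [M [L [HL0 H]]]. destruct (scalar_bl_field j) as [M' [L' [HM' HL']]].
    exists (Rmax M M'), (Rmax L L').
    assert (HmL := Rmax_l L L'). assert (HmR := Rmax_r L L').
    assert (HML := Rmax_l M M'). assert (HMR := Rmax_r M M').
    split; [lra|]. intros i [E | Hi].
    + subst j. split.
      * intros x. specialize (HM' x). lra.
      * intros x y d Hd. eapply Rle_trans; [apply HL'; exact Hd|].
        apply Rmult_le_compat_r; [apply (close_nonneg eps d x y Hd) | exact HmR].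
    + destruct (H i Hi) as [H1 H2]. split.
      * intros x. specialize (H1 x). lra.
      * intros x y d Hd. eapply Rle_trans; [apply H2; exact Hd|].
        apply Rmult_le_compat_r; [apply (close_nonneg eps d x y Hd) | exact HmL]. }
destruct (H (inv_rad :: d_inv_rad :: height :: d_height :: energy_k :: kappa :: eps :: nil)%list)
  as [M [L [HL HF]]].
exists M, L. split; [exact HL|]. split.
- intros x i. apply HF. destruct i; simpl; tauto.
- intros x y d Hd i. apply HF; [destruct i; simpl; tauto | exact Hd].
Qed.

(** * Initial states and the circular orbits at [eps = 0] *)

Definition initial (k kap e : R) (i : coord) : R :=
  match i with
  | inv_rad => 1 | d_inv_rad => 0 | height => 0 | d_height => 1
  | energy_k => k | kappa => kap | eps => e
  end.

Definition frequency (kap : R) : R := sqrt (1 + 7 / 4 * kap).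

Definition circular_orbit (kap t : R) (i : coord) : R :=
  match i with
  | inv_rad => 1 | d_inv_rad => 0
  | height => sin (frequency kap * t) / frequency kap
  | d_height => cos (frequency kap * t)
  | energy_k => 1 | kappa => kap | eps => 0
  end.

Lemma frequency_sqr (kap : R) : 1 <= kap -> frequency kap ^ 2 = 1 + 7 / 4 * kap.
Proof. intros H. apply pow2_sqrt. lra. Qed.

Lemma frequency_ge_1 (kap : R) : 1 <= kap -> 1 <= frequency kap.
Proof. intros H. unfold frequency. rewrite <- sqrt_1 at 1. apply sqrt_le_1_alt. lra. Qed.

Lemma circular_orbit_bounds (kap t : R) : 1 <= kap ->
  -1 <= circular_orbit kap t height <= 1 /\ -1 <= circular_orbit kap t d_height <= 1.
Proof.
intros H. simpl. split; [|apply COS_bound].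
generalize (SIN_bound (frequency kap * t)) (frequency_ge_1 kap H). intros Hs Hf.
apply Rabs_le_between. unfold Rdiv. rewrite Rabs_mult.
rewrite (Rabs_pos_eq (/ _)) by (left; apply Rinv_0_lt_compat; lra).
assert (Rabs (sin (frequency kap * t)) <= 1) by (apply Rabs_le; lra).
apply Rmult_le_reg_r with (frequency kap); [lra|].
rewrite Rmult_assoc, Rinv_l by lra. lra.
Qed.

(** At [eps = 0] the distance ratio is 1, and with s = 1 the height obeys a harmonic oscillator. The
    orbit stays in the box, so truncation does not affect it. *)
Lemma circular_orbit_solution (kap : R) : 1 <= kap <= 3 ->
  ode_solution clamped_field (circular_orbit kap).
Proof.
intros H t.
assert (Hb : in_box (circular_orbit kap t)).
{ generalize (circular_orbit_bounds kap t ltac:(lra)). intros [H1 H2] i.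
  destruct i; simpl in *; lra. }
unfold clamped_field. rewrite truncate_id by exact Hb.
assert (HD : dist_ratio (circular_orbit kap t) = 1).
{ unfold dist_ratio. replace (1 + _) with 1 by (simpl; ring). apply sqrt_1. }
generalize (frequency_ge_1 kap ltac:(lra)) (frequency_sqr kap ltac:(lra)). intros Hf1 Hf2.
intros i. destruct i; cbn [field]; rewrite ?HD; cbn [circular_orbit];
  try (evar_last; [apply @is_derive_const | unfold zero; simpl; ring]).
- auto_derive; [exact I|]. simpl. field. lra.
- auto_derive; [exact I|]. simpl. apply (Rmult_eq_reg_r (frequency kap)); [|lra].
  replace (1 * / 1 * (2 * / (1 * (1 * (1 * 1))) - 1 / 4)) with (7 / 4) by field.
  transitivity (- (frequency kap ^ 2) * sin (frequency kap * t)); [ring|].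
  rewrite Hf2. field. lra.
Qed.

(** * Shooting *)

(** Composing with [clamp] extends [f] continuously to the line, as the intermediate value theorem
    requires. A negative [K] is possible only when [a = b]. *)
Lemma lipschitz_ivt (f : R -> R) (K a b : R) :
  a <= b ->
  (forall x y, a <= x <= b -> a <= y <= b -> Rabs (f x - f y) <= K * Rabs (x - y)) ->
  f a <= 0 <= f b -> exists x, a <= x <= b /\ f x = 0.
Proof.
intros Hab Hf H0.
assert (HK : 0 <= K \/ a = b).
{ destruct (Req_dec a b) as [E | E]; [right; exact E | left].
  generalize (Hf a b ltac:(lra) ltac:(lra)) (Rabs_pos (f a - f b)).
  rewrite (Rabs_left1 (a - b)) by lra. intros. nra. }
destruct HK as [HK | E]; [|subst b; exists a; lra].
destruct (IVT_gen (fun x => f (clamp a b x)) a b 0) as [x [_ Hx]].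
- intros t. apply continuity_pt_filterlim. apply (lipschitz_continuous (fun x => f (clamp a b x)) K). intros r s.
  eapply Rle_trans; [apply Hf; apply clamp_between; exact Hab|].
  apply Rmult_le_compat_l; [exact HK | apply clamp_lipschitz].
- rewrite !clamp_id by lra. rewrite Rmin_left, Rmax_right by lra. exact H0.
- exists (clamp a b x). split; [apply clamp_between; exact Hab | exact Hx].
Qed.

Lemma ode_constant_coord (phi : R -> coord -> R) (i : coord) :
  ode_solution clamped_field phi -> (forall x, field x i = 0) ->
  forall t, phi t i = phi 0 i.
Proof.
intros Hphi Hi t.
assert (H : Rabs (phi t i - phi 0 i) <= 0 * Rabs (t - 0)).
{ apply (bounded_derive_lipschitz (fun t => phi t i) (fun _ => 0)).
  - intros s. rewrite <- (Hi (truncate (phi s))). apply Hphi.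
  - intros _. rewrite Rabs_R0. lra. }
rewrite Rmult_0_l in H. apply Rabs_le_between in H. lra.
Qed.

(** The reversing involution: reversal of the angle changes the signs of s' and V', reflection of
    the height those of V and V', so together they flip s' and V only. *)
Definition reverse (x : coord -> R) (i : coord) : R :=
  match i with d_inv_rad | height => - x i | _ => x i end.

Lemma reverse_truncate (x : coord -> R) : truncate (reverse x) = reverse (truncate x).
Proof.
apply functional_extensionality. intros i.
destruct i; try reflexivity; apply (clamp_opp 2); lra.
Qed.

Lemma reverse_in_box (x : coord -> R) : in_box x -> in_box (reverse x).
Proof. intros H i. specialize (H i). destruct i; simpl in *; lra. Qed.

Lemma reverse_field (x : coord -> R) (i : coord) :
  clamped_field (reverse x) i = - reverse (clamped_field x) i.
Proof.
unfold clamped_field. rewrite reverse_truncate. generalize (truncate x). clear x. intros x.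
assert (HD : dist_ratio (reverse x) = dist_ratio x).
{ unfold dist_ratio. f_equal. simpl. ring. }
destruct i; cbn [field reverse]; unfold planar_defect; rewrite ?HD; cbn [reverse]; ring.
Qed.

Lemma reverse_solution (phi : R -> coord -> R) (a : R) :
  ode_solution clamped_field phi ->
  ode_solution clamped_field (fun t => reverse (phi (a - t))).
Proof.
intros H t i. rewrite reverse_field.
assert (Hd := fun j => is_derive_reflect (fun s => phi s j) a t _ (H (a - t) j)). cbv beta in Hd.
destruct i; cbn [reverse]; try apply Hd;
  apply (is_derive_opp (fun s => phi (a - s) _)), Hd.
Qed.

Lemma shift_solution (phi : R -> coord -> R) (a : R) :
  ode_solution clamped_field phi -> ode_solution clamped_field (fun t => phi (a + t)).
Proof.
intros H t i. evar_last.
- apply (is_derive_comp (fun s => phi s i) (fun t => a + t)); [apply H|].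
  auto_derive; [exact I | reflexivity].
- unfold scal; simpl; unfold mult; simpl; ring.
Qed.

(** The two conditions say that the state at [a] is fixed by [reverse]; both sides then solve the
    same initial value problem. *)
Lemma reversal_symmetry (phi : R -> coord -> R) (a : R) :
  ode_solution clamped_field phi -> phi a d_inv_rad = 0 -> phi a height = 0 ->
  forall t, phi (a + t) = reverse (phi (a - t)).
Proof.
intros H H1 H2 t. apply functional_extensionality. intros i.
destruct field_bounded_lipschitz as [M [L [HL HF]]].
apply (ode_unique M L _ (fun t => phi (a + t)) (fun t => reverse (phi (a - t))) HL HF).
- apply shift_solution, H.
- apply reverse_solution, H.
- intros j. rewrite Rplus_0_r, Rminus_0_r. destruct j; simpl; rewrite ?H1, ?H2; ring.
Qed.

(** The reflections of the angle about 0 and about [a] compose to the translation by [2 * a]. *)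
Lemma two_symmetries_periodic (phi : R -> coord -> R) (a : R) :
  ode_solution clamped_field phi ->
  phi 0 d_inv_rad = 0 -> phi 0 height = 0 -> phi a d_inv_rad = 0 -> phi a height = 0 ->
  forall t, phi (t + 2 * a) = phi t.
Proof.
intros H H1 H2 H3 H4 t.
replace (t + 2 * a) with (a + (t + a)) by ring.
rewrite (reversal_symmetry phi a) by assumption.
replace (a - (t + a)) with (0 - t) by ring.
rewrite <- (reversal_symmetry phi 0) by assumption. f_equal. ring.
Qed.

(** Reflection about [a] carries the box property from [[0, a]] to [[0, 2a]], periodicity to all
    nonnegative angles, and reflection about 0 to the negative ones. *)
Lemma two_symmetries_in_box (phi : R -> coord -> R) (a : R) :
  0 < a -> ode_solution clamped_field phi ->
  phi 0 d_inv_rad = 0 -> phi 0 height = 0 -> phi a d_inv_rad = 0 -> phi a height = 0 ->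
  (forall t, 0 <= t <= a -> in_box (phi t)) -> forall t, in_box (phi t).
Proof.
intros Ha H H1 H2 H3 H4 Hb.
assert (Hp := two_symmetries_periodic phi a H H1 H2 H3 H4).
assert (Hn : forall n t, 0 <= t <= INR (S n) * a -> in_box (phi t)).
{ induction n as [|n IH]; intros t Ht.
  - apply Hb. simpl in Ht. lra.
  - destruct (Rle_dec t a) as [Hta | Hta]; [apply Hb; lra|].
    rewrite !S_INR in *. assert (0 <= INR n) by apply pos_INR.
    destruct (Rle_dec t (2 * a)) as [H2a | H2a].
    + replace t with (a + (t - a)) by ring. rewrite (reversal_symmetry phi a) by assumption.
      apply reverse_in_box, IH. nra.
    + replace t with ((t - 2 * a) + 2 * a) by ring. rewrite Hp. apply IH. nra. }
assert (Hpos : forall t, 0 <= t -> in_box (phi t)).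
{ intros t Ht. destruct (INR_unbounded (t / a)) as [n Hna].
  apply (Hn n). split; [exact Ht|]. rewrite S_INR.
  apply (Rmult_lt_compat_r a) in Hna; [|exact Ha].
  replace (t / a * a) with t in Hna by (field; lra). lra. }
intros t. destruct (Rle_dec 0 t) as [Ht | Ht]; [apply Hpos; exact Ht|].
replace t with (0 + t) by ring. rewrite (reversal_symmetry phi 0) by assumption.
apply reverse_in_box, Hpos. lra.
Qed.

(** The term [k * cos t] cancels the constant forcing [k] in s'' + s = k + O(e^2), so only the
    defect remains. *)
Lemma planar_shooting_derive (phi : R -> coord -> R) (k kap e : R) :
  ode_solution clamped_field phi -> (forall i, phi 0 i = initial k kap e i) ->
  forall t, in_box (phi t) ->
  is_derive (fun t => phi t d_inv_rad * sin t - phi t inv_rad * cos t + k * cos t) t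
            (- (e ^ 2 * planar_defect (truncate (phi t)) * sin t)).
Proof.
intros H H0 t Hb.
assert (H1 := H t inv_rad). assert (H2 := H t d_inv_rad).
assert (Hk := ode_constant_coord phi energy_k H (fun _ => eq_refl) t).
assert (He := ode_constant_coord phi eps H (fun _ => eq_refl) t).
rewrite H0 in Hk, He. simpl in Hk, He.
unfold clamped_field in H1, H2. rewrite truncate_id in * by exact Hb.
cbn [field] in H1, H2. rewrite Hk, He in H2.
evar_last.
- apply @is_derive_plus; [apply @is_derive_minus; apply Derive.is_derive_mult|].
  + exact H2.
  + apply is_derive_sin.
  + exact H1.
  + apply is_derive_cos.
  + apply is_derive_scal, is_derive_cos.
- unfold minus, plus, opp, scal; simpl; unfold mult; simpl. ring.
Qed.

Lemma PI2_bounds : 0 < PI / 2 <= 2.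
Proof. generalize PI_RGT_0 PI_4. lra. Qed.

(** The quantity of [planar_shooting_derive] equals [k - 1] at 0 and s' at [PI / 2]. The factor 2
    bounds the length [PI / 2] of the interval. *)
Lemma planar_shooting_value (phi : R -> coord -> R) (k kap e M : R) :
  ode_solution clamped_field phi -> (forall i, phi 0 i = initial k kap e i) ->
  (forall t, 0 <= t <= PI / 2 -> in_box (phi t)) ->
  (forall x, Rabs (planar_defect (truncate x)) <= M) ->
  Rabs (phi (PI / 2) d_inv_rad - (k - 1)) <= e ^ 2 * M * 2.
Proof.
intros H H0 Hb HM. generalize PI2_bounds. intros HPI.
assert (HM0 : 0 <= e ^ 2 * M).
{ apply Rmult_le_pos; [apply pow2_ge_0 | eapply Rle_trans; [apply Rabs_pos | apply (HM (phi 0))]]. }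
generalize (derive_abs_le _ _ (fun t => e ^ 2 * M * t) (fun _ => e ^ 2 * M) 0 (PI / 2) ltac:(lra)
  (fun t Ht => planar_shooting_derive phi k kap e H H0 t (Hb t Ht))).
intros HD. cbv beta in HD. rewrite !H0, sin_PI2, cos_PI2, sin_0, cos_0 in HD. cbn [initial] in HD.
replace (phi (PI / 2) d_inv_rad - (k - 1))
  with (phi (PI / 2) d_inv_rad * 1 - phi (PI / 2) inv_rad * 0 + k * 0 - (0 * 0 - 1 * 1 + k * 1)) by ring.
eapply Rle_trans; [apply HD|].
- intros t _. auto_derive; [exact I | ring].
- intros t Ht. rewrite Rabs_Ropp, !Rabs_mult, (Rabs_pos_eq (e ^ 2)) by (apply pow2_ge_0).
  replace (e ^ 2 * M) with (e ^ 2 * M * 1) by ring.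
  apply Rmult_le_compat; auto using Rabs_pos.
  + apply Rmult_le_pos; [apply pow2_ge_0 | apply Rabs_pos].
  + apply Rmult_le_compat_l; [apply pow2_ge_0 | apply HM].
  + apply Rabs_le, SIN_bound.
- nra.
Qed.

(** The same identity for the difference of two solutions with common [e]. The error is small
    relative to the distance of the solutions, which gives control on how the root [k] varies with
    [kappa]. *)
Lemma planar_shooting_difference (phi psi : R -> coord -> R) (k k' kap kap' e d L : R) :
  ode_solution clamped_field phi -> (forall i, phi 0 i = initial k kap e i) ->
  ode_solution clamped_field psi -> (forall i, psi 0 i = initial k' kap' e i) ->
  (forall t, 0 <= t <= PI / 2 -> in_box (phi t)) ->
  (forall t, 0 <= t <= PI / 2 -> in_box (psi t)) ->
  (forall t, 0 <= t <= PI / 2 -> coord_close d (phi t) (psi t)) ->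
  (forall x y r, coord_close r x y ->
    Rabs (planar_defect (truncate x) - planar_defect (truncate y)) <= L * r) ->
  Rabs ((phi (PI / 2) d_inv_rad - psi (PI / 2) d_inv_rad) - (k - k')) <= e ^ 2 * (L * d) * 2.
Proof.
intros H H0 H' H0' Hb Hb' Hd HL. generalize PI2_bounds. intros HPI.
assert (He := pow2_ge_0 e).
assert (HM0 : 0 <= e ^ 2 * (L * d)).
{ apply Rmult_le_pos; [exact He | eapply Rle_trans; [apply Rabs_pos | apply (HL (phi 0) (psi 0) d)]].
  apply Hd. lra. }
generalize (derive_abs_le _ _ (fun t => e ^ 2 * (L * d) * t) (fun _ => e ^ 2 * (L * d)) 0 (PI / 2) ltac:(lra)
  (fun t Ht => is_derive_minus _ _ _ _ _ (planar_shooting_derive phi k kap e H H0 t (Hb t Ht))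
                 (planar_shooting_derive psi k' kap' e H' H0' t (Hb' t Ht)))).
intros HD. unfold minus, plus, opp in HD. cbn -[pow PI sin cos planar_defect] in HD.
rewrite !H0, !H0', sin_PI2, cos_PI2, sin_0, cos_0 in HD. cbn [initial] in HD.
replace (phi (PI / 2) d_inv_rad - psi (PI / 2) d_inv_rad - (k - k'))
  with (phi (PI / 2) d_inv_rad * 1 - phi (PI / 2) inv_rad * 0 + k * 0 +
        - (psi (PI / 2) d_inv_rad * 1 - psi (PI / 2) inv_rad * 0 + k' * 0) -
        (0 * 0 - 1 * 1 + k * 1 + - (0 * 0 - 1 * 1 + k' * 1))) by ring.
eapply Rle_trans; [apply HD|].
- intros t _. auto_derive; [exact I | ring].
- intros t Ht.
  replace (- (e ^ 2 * planar_defect (truncate (phi t)) * sin t) +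
    - - (e ^ 2 * planar_defect (truncate (psi t)) * sin t))
   with (- (e ^ 2 * (planar_defect (truncate (phi t)) - planar_defect (truncate (psi t))) * sin t)) by ring.
  rewrite Rabs_Ropp, !Rabs_mult, (Rabs_pos_eq (e ^ 2)) by exact He.
  replace (e ^ 2 * (L * d)) with (e ^ 2 * (L * d) * 1) by ring.
  apply Rmult_le_compat; auto using Rabs_pos.
  + apply Rmult_le_pos; [exact He | apply Rabs_pos].
  + apply Rmult_le_compat_l; [exact He | apply HL, Hd, Ht].
  + apply Rabs_le, SIN_bound.
- nra.
Qed.

(** Since the parameters are coordinates, the single constant [Lam] governs dependence on them as
    well as on the initial position and velocity. *)
Lemma flow_exists :
  exists (flow : (coord -> R) -> R -> coord -> R) (Lam : R),
    1 <= Lam /\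
    (forall x, ode_solution clamped_field (flow x)) /\
    (forall x i, flow x 0 i = x i) /\
    (forall phi psi d, ode_solution clamped_field phi -> ode_solution clamped_field psi ->
       coord_close d (phi 0) (psi 0) ->
       forall t, 0 <= t <= PI / 2 -> coord_close (Lam * d) (phi t) (psi t)).
Proof.
destruct field_bounded_lipschitz as [M [L [HL HF]]].
exists (fun x => proj1_sig (constructive_indefinite_description _ (ode_exists M L _ x HL HF))).
(* The last 2 is an upper bound for [PI / 2]. *)
exists (exp (2 * L * 2)). split; [|split; [|split]].
- generalize (exp_abs_ge_1 (2 * L) 2 ltac:(lra)). rewrite Rabs_pos_eq; lra.
- intros x. destruct constructive_indefinite_description as [phi [H1 H2]]. exact H1.
- intros x. destruct constructive_indefinite_description as [phi [H1 H2]]. exact H2.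
- intros phi psi d H1 H2 Hd t Ht i. generalize PI2_bounds. intros HPI.
  eapply Rle_trans; [apply (ode_gronwall M L _ phi psi d HL HF H1 H2 Hd)|].
  rewrite Rmult_comm. apply Rmult_le_compat_r; [eapply (close_nonneg eps); exact Hd|].
  rewrite (Rabs_pos_eq t) by lra.
  destruct (Req_dec (2 * L * t) (2 * L * 2)) as [E | E]; [rewrite E; lra|].
  left. apply exp_increasing.
  assert (2 * L * t <= 2 * L * 2) by (apply Rmult_le_compat_l; lra). lra.
Qed.

Lemma close_to_circular_in_box (phi : R -> coord -> R) (k kap e t : R) :
  ode_solution clamped_field phi -> (forall i, phi 0 i = initial k kap e i) ->
  8 / 7 <= kap <= 16 / 7 ->
  coord_close (1 / 8) (phi t) (circular_orbit kap t) -> in_box (phi t).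
Proof.
intros H H0 Hkap Hc i.
destruct (circular_orbit_bounds kap t ltac:(lra)) as [B1 B2].
specialize (Hc i). apply Rabs_le_between in Hc.
destruct i; cbn [circular_orbit] in *; cbn [lower upper]; lra.
Qed.

(** The frequencies are sqrt 3 < 2 and sqrt 5 between 2 and 4, so half of pi times the frequency
    lies below pi in the first case and between pi and 2 pi in the second. *)
Lemma circular_shooting_signs :
  0 < circular_orbit (8 / 7) (PI / 2) height /\ circular_orbit (16 / 7) (PI / 2) height < 0.
Proof.
cbn [circular_orbit]. generalize PI_RGT_0. intros HPI.
assert (F1 := frequency_ge_1 (8 / 7) ltac:(lra)). assert (F2 := frequency_sqr (8 / 7) ltac:(lra)).
assert (G1 := frequency_ge_1 (16 / 7) ltac:(lra)). assert (G2 := frequency_sqr (16 / 7) ltac:(lra)).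
split.
- apply Rdiv_lt_0_compat; [|lra]. apply sin_gt_0; [nra|].
  assert (frequency (8 / 7) < 2) by nra. nra.
- assert (2 < frequency (16 / 7)) by nra. assert (frequency (16 / 7) < 4) by nra.
  assert (sin (frequency (16 / 7) * (PI / 2)) < 0) by (apply sin_lt_0; nra).
  apply Ropp_lt_cancel. rewrite Ropp_0. unfold Rdiv.
  rewrite <- Ropp_mult_distr_l_reverse. apply Rdiv_lt_0_compat; lra.
Qed.

Lemma shooting_solution :
  exists e0, 0 < e0 <= 1 / 100 /\ forall e, 0 < e < e0 ->
  exists k kap phi,
    8 / 7 <= kap <= 16 / 7 /\ Rabs (k - 1) <= 1 / 100 /\
    ode_solution clamped_field phi /\ (forall i, phi 0 i = initial k kap e i) /\
    phi (PI / 2) d_inv_rad = 0 /\ phi (PI / 2) height = 0 /\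
    (forall t, 0 <= t <= PI / 2 -> in_box (phi t)).
Proof.
destruct flow_exists as [flow [Lam [HLam [Hsol [Hini Hclose]]]]].
destruct scalar_bl_planar_defect as [Mh [Lh [HMh HLh]]].
destruct circular_shooting_signs as [S1 S2].
(* In this proof [m1] and [m2] are the two limiting heights at [PI / 2], not masses. *)
set (m1 := circular_orbit (8 / 7) (PI / 2) height) in *.
set (m2 := circular_orbit (16 / 7) (PI / 2) height) in *.
(* The four bounds serve the final estimate on [k], the margin 1/8 of the box, and the persistence
   of the two signs of the height. *)
pose (d := Rmin (Rmin (1 / 100) (1 / (8 * Lam))) (Rmin (m1 / Lam) (- m2 / Lam))).
assert (Hd0 : 0 < d).
{ unfold d. repeat apply Rmin_glb_lt; try lra; apply Rdiv_lt_0_compat; lra. }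
assert (Hd1 : d <= 1 / 100) by (unfold d; eapply Rle_trans; apply Rmin_l).
assert (Hd2 : Lam * d <= 1 / 8).
{ assert (H : d <= 1 / (8 * Lam)) by (unfold d; eapply Rle_trans; [apply Rmin_l | apply Rmin_r]).
  apply (Rmult_le_compat_l Lam) in H; [|lra].
  replace (Lam * (1 / (8 * Lam))) with (1 / 8) in H by (field; lra). exact H. }
assert (Hd3 : Lam * d <= m1).
{ assert (H : d <= m1 / Lam) by (unfold d; eapply Rle_trans; [apply Rmin_r | apply Rmin_l]).
  apply (Rmult_le_compat_l Lam) in H; [|lra].
  replace (Lam * (m1 / Lam)) with m1 in H by (field; lra). exact H. }
assert (Hd4 : Lam * d <= - m2).
{ assert (H : d <= - m2 / Lam) by (unfold d; eapply Rle_trans; apply Rmin_r).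
  apply (Rmult_le_compat_l Lam) in H; [|lra].
  replace (Lam * (- m2 / Lam)) with (- m2) in H by (field; lra). exact H. }
clearbody d.
(* [C] dominates the coefficients of [e ^ 2] in both planar shooting estimates. Absolute values are
   taken because the constants come without a sign. *)
pose (C := 2 * (Rabs Mh + Rabs Lh * Lam + 1)).
assert (HC : 2 <= C).
{ unfold C. generalize (Rabs_pos Mh) (Rabs_pos Lh). intros. nra. }
assert (HCM : Mh * 2 <= C).
{ unfold C. generalize (Rle_abs Mh) (Rabs_pos Lh). intros. nra. }
assert (HCL : Lh * Lam * 2 <= C).
{ unfold C. generalize (Rabs_pos Mh) (Rle_abs Lh). intros. nra. }
clearbody C.
(* For [e] below this value [e * C <= d] and [e <= 1 / 100], so [e ^ 2 * C] is at most [d] and hence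
   at most 1/2. *)
exists (d / C).
assert (HdC : d / C <= d).
{ apply (Rmult_le_reg_r C); [lra|]. replace (d / C * C) with d by (field; lra). nra. }
split; [split; [apply Rdiv_lt_0_compat; lra | lra]|].
intros e He.
assert (He1 : e ^ 2 * C <= d).
{ assert (H : e * C <= d).
  { apply Rle_trans with (d / C * C); [apply Rmult_le_compat_r; lra|].
    apply Req_le. field. lra. }
  nra. }
pose (sol k kap := flow (initial k kap e)).
assert (Hcirc : forall k kap t, Rabs (k - 1) <= d -> 8 / 7 <= kap <= 16 / 7 -> 0 <= t <= PI / 2 ->
                coord_close (Lam * d) (sol k kap t) (circular_orbit kap t)).
{ intros k kap t Hk Hkap Ht. apply Hclose.
  - apply Hsol.
  - apply circular_orbit_solution. lra.
  - intros i. unfold sol. rewrite Hini. destruct i; cbn [initial circular_orbit];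
      rewrite ?Rmult_0_r, ?sin_0, ?cos_0; try (rewrite Rminus_diag, Rabs_R0; lra).
    + unfold Rdiv. rewrite Rmult_0_l, Rminus_diag, Rabs_R0. lra.
    + exact Hk.
    + rewrite Rminus_0_r, Rabs_pos_eq; lra.
  - exact Ht. }
assert (Hbox : forall k kap t, Rabs (k - 1) <= d -> 8 / 7 <= kap <= 16 / 7 -> 0 <= t <= PI / 2 ->
               in_box (sol k kap t)).
{ intros k kap t Hk Hkap Ht. apply (close_to_circular_in_box (sol k kap) k kap e t).
  - apply Hsol.
  - intros i. apply Hini.
  - exact Hkap.
  - intros i. eapply Rle_trans; [apply Hcirc; assumption | exact Hd2]. }
assert (Hlip : forall k k' kap kap' r t, Rabs (k - k') <= r -> Rabs (kap - kap') <= r -> 0 <= t <= PI / 2 ->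
               coord_close (Lam * r) (sol k kap t) (sol k' kap' t)).
{ intros k k' kap kap' r t Hk Hkap Ht. apply Hclose; try apply Hsol; [|exact Ht].
  intros i. unfold sol. rewrite !Hini. generalize (Rabs_pos (k - k')). intros Hp.
  destruct i; cbn [initial]; try assumption; rewrite Rminus_diag, Rabs_R0; lra. }
assert (HPI2 : 0 <= PI / 2 <= PI / 2) by (generalize PI2_bounds; lra).
(* The range condition stands inside the existential so that choice yields a function [K] on all
   reals; the value outside the range is arbitrary. *)
assert (HK : forall kap, exists k, 8 / 7 <= kap <= 16 / 7 ->
             Rabs (k - 1) <= d /\ sol k kap (PI / 2) d_inv_rad = 0).
{ intros kap.
  destruct (excluded_middle_informative (8 / 7 <= kap <= 16 / 7)) as [Hkap | Hkap];
    [|exists 0; intros H; contradiction].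
  assert (Hv : forall k, Rabs (k - 1) <= d ->
          Rabs (sol k kap (PI / 2) d_inv_rad - (k - 1)) <= d).
  { intros k Hk. eapply Rle_trans.
    - apply (planar_shooting_value (sol k kap) k kap e Mh).
      + apply Hsol.
      + intros i. apply Hini.
      + intros t Ht. apply Hbox; assumption.
      + exact HMh.
    - generalize (pow2_ge_0 e). nra. }
  (* At the endpoints the main term [k - 1] is [- d] and [d], while the error is at most [d]; this
     fixes the signs. *)
  destruct (lipschitz_ivt (fun k => sol k kap (PI / 2) d_inv_rad) Lam (1 - d) (1 + d)) as [k [Hk E]].
  - lra.
  - intros x y _ _. apply Hlip; [lra | rewrite Rminus_diag, Rabs_R0; apply Rabs_pos | exact HPI2].
  - assert (V1 := Hv (1 - d) ltac:(apply Rabs_le; lra)).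
    assert (V2 := Hv (1 + d) ltac:(apply Rabs_le; lra)).
    apply Rabs_le_between in V1. apply Rabs_le_between in V2. lra.
  - exists k. intros _. split; [apply Rabs_le; lra | exact E]. }
destruct (choice _ HK) as [K HK']. clear HK.
(* [K] comes from choice, so its continuity has to be proved. Both shooting values vanish, which
   bounds the variation of [K] by half of the maximum of itself and [Rabs (x - y)]. *)
assert (HKlip : forall x y, 8 / 7 <= x <= 16 / 7 -> 8 / 7 <= y <= 16 / 7 ->
                Rabs (K x - K y) <= Rabs (x - y)).
{ intros x y Hx Hy. destruct (HK' x Hx) as [K1 E1]. destruct (HK' y Hy) as [K2 E2].
  set (r := Rmax (Rabs (K x - K y)) (Rabs (x - y))).
  assert (Hdiff : Rabs ((sol (K x) x (PI / 2) d_inv_rad - sol (K y) y (PI / 2) d_inv_rad)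
                        - (K x - K y)) <= e ^ 2 * (Lh * (Lam * r)) * 2).
  { apply (planar_shooting_difference (sol (K x) x) (sol (K y) y) (K x) (K y) x y); try apply Hsol.
    - intros i. apply Hini.
    - intros i. apply Hini.
    - intros t Ht. apply Hbox; assumption.
    - intros t Ht. apply Hbox; assumption.
    - intros t Ht. apply Hlip; [apply Rmax_l | apply Rmax_r | exact Ht].
    - exact HLh. }
  rewrite E1, E2 in Hdiff.
  replace (0 - 0 - (K x - K y)) with (- (K x - K y)) in Hdiff by ring. rewrite Rabs_Ropp in Hdiff.
  assert (Hr : 0 <= r) by (eapply Rle_trans; [apply Rabs_pos | apply Rmax_r]).
  assert (Hhalf : Rabs (K x - K y) <= 1 / 2 * r).
  { eapply Rle_trans; [exact Hdiff|].
    replace (e ^ 2 * (Lh * (Lam * r)) * 2) with (e ^ 2 * (Lh * Lam * 2) * r) by ring.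
    apply Rmult_le_compat_r; [exact Hr|].
    apply Rle_trans with (e ^ 2 * C); [apply Rmult_le_compat_l; [apply pow2_ge_0 | exact HCL]|lra]. }
  unfold r in Hhalf, Hr. generalize (Rabs_pos (K x - K y)) (Rabs_pos (x - y)). intros Hp Hq. revert Hhalf Hr.
  unfold Rmax. destruct Rle_dec; intros; lra. }
(* The minus sign is there because the height at [PI / 2] goes from positive to negative as [kap]
   increases. *)
destruct (lipschitz_ivt (fun kap => - sol (K kap) kap (PI / 2) height) Lam (8 / 7) (16 / 7))
  as [kap [Hkap E]].
- lra.
- intros x y Hx Hy. rewrite <- Rabs_Ropp.
  replace (- (- sol (K x) x (PI / 2) height - - sol (K y) y (PI / 2) height))
    with (sol (K x) x (PI / 2) height - sol (K y) y (PI / 2) height) by ring.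
  apply Hlip; [apply HKlip; assumption | lra | exact HPI2].
- destruct (HK' (8 / 7) ltac:(lra)) as [K1 _]. destruct (HK' (16 / 7) ltac:(lra)) as [K2 _].
  generalize (Hcirc _ (8 / 7) _ K1 ltac:(lra) HPI2 height)
             (Hcirc _ (16 / 7) _ K2 ltac:(lra) HPI2 height).
  fold m1 m2. intros V1 V2. apply Rabs_le_between in V1. apply Rabs_le_between in V2. lra.
- destruct (HK' kap Hkap) as [K1 E1].
  exists (K kap), kap, (sol (K kap) kap).
  repeat match goal with |- _ /\ _ => split end; try lra; try assumption.
  + apply Hsol.
  + intros i. apply Hini.
  + intros t Ht. apply Hbox; assumption.
Qed.

(** The orbit stays in the box for all angles, so truncation disappears and the constant coordinates
    become parameters. The period pi is applied twice to match one full turn of the polar angle. *)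
Lemma reduced_periodic_solution :
  exists e0, 0 < e0 <= 1 / 100 /\ forall e, 0 < e < e0 ->
  exists k kap (s ds v dv : R -> R),
    8 / 7 <= kap <= 16 / 7 /\ Rabs (k - 1) <= 1 / 100 /\
    s 0 = 1 /\ ds 0 = 0 /\ v 0 = 0 /\ dv 0 = 1 /\
    (forall t, 1 / 2 <= s t <= 3 / 2) /\ (forall t, -2 <= ds t <= 2) /\
    (forall t, s (t + 2 * PI) = s t) /\ (forall t, v (t + 2 * PI) = v t) /\
    (forall t, is_derive s t (ds t)) /\
    (forall t, is_derive ds t
       (- s t + ((k - kap / 4) * / sqrt (1 + (e * v t) ^ 2) ^ 3 + kap / 4))) /\
    (forall t, is_derive v t (dv t)) /\
    (forall t, is_derive dv t
       (- v t - kap * / s t * (2 * / sqrt (1 + (e * v t) ^ 2) ^ 3 - 1 / 4) * v t)).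
Proof.
destruct shooting_solution as [e0 [He0 H]]. exists e0. split; [exact He0|].
intros e He. destruct (H e He) as [k [kap [phi [Hkap [Hk [Hsol [Hini [E1 [E2 Hbox]]]]]]]]]. clear H.
assert (I1 : phi 0 d_inv_rad = 0) by (rewrite Hini; reflexivity).
assert (I2 : phi 0 height = 0) by (rewrite Hini; reflexivity).
assert (Hb := two_symmetries_in_box phi (PI / 2) (proj1 PI2_bounds) Hsol I1 I2 E1 E2 Hbox).
assert (Hp := two_symmetries_periodic phi (PI / 2) Hsol I1 I2 E1 E2).
assert (Hp2 : forall t, phi (t + 2 * PI) = phi t).
{ intros t. rewrite <- (Hp t), <- (Hp (t + 2 * (PI / 2))). f_equal. field. }
assert (Hf : forall t i, is_derive (fun s => phi s i) t (field (phi t) i)).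
{ intros t i. rewrite <- (truncate_id (phi t)) by apply Hb. apply Hsol. }
assert (P : forall t, phi t energy_k = k /\ phi t kappa = kap /\ phi t eps = e).
{ intros t.
  assert (Hc : forall i, (forall x, field x i = 0) -> phi t i = initial k kap e i).
  { intros i Hi. rewrite <- Hini. apply ode_constant_coord; assumption. }
  repeat split; apply Hc; reflexivity. }
exists k, kap, (fun t => phi t inv_rad), (fun t => phi t d_inv_rad),
  (fun t => phi t height), (fun t => phi t d_height).
repeat match goal with |- _ /\ _ => split end; try lra; try (rewrite Hini; reflexivity);
  try exact Hk; intros t.
- apply (Hb t inv_rad).
- apply (Hb t d_inv_rad).
- rewrite Hp2. reflexivity.
- rewrite Hp2. reflexivity.
- apply Hf.
- generalize (Hf t d_inv_rad). cbn [field]. unfold Rminus. rewrite Rplus_assoc.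
  fold (phi t energy_k - phi t eps ^ 2 * planar_defect (phi t)). rewrite planar_defect_spec.
  unfold dist_ratio. destruct (P t) as [P1 [P2 P3]]. rewrite P1, P2, P3. intros X; exact X.
- apply Hf.
- generalize (Hf t d_height). cbn [field].
  unfold dist_ratio. destruct (P t) as [P1 [P2 P3]]. rewrite P2, P3. intros X; exact X.
Qed.

(** * Motion in space *)

(** Angular momentum 1 gives the polar angle the speed 1/r^2 = s^2, which recovers physical time.
    The bounds on s make this equation globally solvable. *)
Lemma time_change (s ds : R -> R) :
  (forall t, 1 / 2 <= s t <= 3 / 2) -> (forall t, -2 <= ds t <= 2) ->
  (forall t, is_derive s t (ds t)) -> (forall t, s (t + 2 * PI) = s t) ->
  exists (th : R -> R) (T : R), 0 < T /\ th 0 = 0 /\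
    (forall t, is_derive th t (s (th t) ^ 2)) /\
    (forall t, th (t + T) = th t + 2 * PI).
Proof.
intros Hs Hds Hd Hper.
(* A scalar equation as a system indexed by [unit]. Its constants are (3/2)^2 = 9/4 as bound and 2 *
   3 = 6 as Lipschitz constant. *)
pose (F := fun (x : unit -> R) (_ : unit) => s (x tt) ^ 2).
assert (HF : bounded_lipschitz (9 / 4) 6 F).
{ split; intros x.
  - intros i. unfold F. specialize (Hs (x tt)). apply Rabs_le. nra.
  - intros y d H i. assert (Hxy := H tt). unfold F.
    assert (HL := bounded_derive_lipschitz s ds 2 Hd (fun t => proj2 (Rabs_le_between _ _) (Hds t)) (x tt) (y tt)).
    replace (s (x tt) ^ 2 - s (y tt) ^ 2) with ((s (x tt) - s (y tt)) * (s (x tt) + s (y tt))) by ring.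
    rewrite Rabs_mult.
    replace (6 * d) with ((2 * d) * 3) by ring.
    apply Rmult_le_compat; try apply Rabs_pos; [lra|].
    generalize (Hs (x tt)) (Hs (y tt)). intros. apply Rabs_le. lra. }
destruct (ode_exists (9 / 4) 6 F (fun _ => 0) ltac:(lra) HF) as [phi [Hphi H0]].
pose (th t := phi t tt).
assert (Hth : forall t, is_derive th t (s (th t) ^ 2)) by (intros t; apply (Hphi t tt)).
assert (HPI := PI_RGT_0).
assert (Hth0 : th 0 = 0) by apply H0.
(* The speed is at least 1/4, so the angle reaches 2 pi by time 8 pi. *)
assert (HT : exists T, 0 <= T <= 8 * PI /\ th T - 2 * PI = 0).
{ apply (lipschitz_ivt (fun T => th T - 2 * PI) (9 / 4)); [lra| |split].
  - intros x y _ _. replace (th x - 2 * PI - (th y - 2 * PI)) with (th x - th y) by ring.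
    apply (bounded_derive_lipschitz th _ _ Hth).
    intros t. generalize (Hs (th t)). intros. apply Rabs_le. nra.
  - lra.
  - assert (H : th 0 - 1 / 4 * 0 <= th (8 * PI) - 1 / 4 * (8 * PI)); [|lra].
    apply (derive_nonneg_le (fun t => th t - 1 / 4 * t) (fun t => s (th t) ^ 2 - 1 / 4)); [lra| |].
    + intros t _. apply (is_derive_minus th (fun t => 1 / 4 * t)); [apply Hth|].
      auto_derive; [exact I | ring].
    + intros t _. generalize (Hs (th t)). nra. }
destruct HT as [T [HT1 HT2]].
exists th, T. split; [|split; [exact Hth0 | split; [exact Hth|]]].
- destruct (Req_dec T 0) as [E | E]; [rewrite E in HT2; lra | lra].
- intros t. symmetry.
  (* As s is 2 pi-periodic, both functions solve the same equation, and they agree at time 0. *)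
  apply (ode_unique (9 / 4) 6 F (fun t _ => th t + 2 * PI) (fun t _ => th (t + T)) ltac:(lra) HF).
  + intros r i. unfold F. rewrite Hper. evar_last.
    * apply @is_derive_plus; [apply Hth | apply is_derive_const].
    * apply plus_zero_r.
  + intros r i. unfold F. evar_last.
    * apply (is_derive_comp th (fun r => r + T)); [apply Hth|].
      auto_derive; [exact I | reflexivity].
    * unfold scal; simpl; unfold mult; simpl; ring.
  + intros _. rewrite Hth0, !Rplus_0_l. lra.
  + exact tt.
Qed.

(** * Vector-valued derivatives and Newton's equations in coordinates *)

Lemma is_derive_pair {U V : NormedModule R_AbsRing} (f : R -> U) (g : R -> V) (t : R) (df : U) (dg : V) :
  is_derive f t df -> is_derive g t dg ->
  @is_derive R_AbsRing (prod_NormedModule R_AbsRing U V) (fun s => (f s, g s)) t (df, dg).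
Proof.
intros Hf Hg.
apply (filterdiff_ext_lin _ (fun y : R => (scal y df, scal y dg))); [|intros y; reflexivity].
apply (filterdiff_comp'_2 (W := prod_NormedModule R_AbsRing U V) f g (fun u v => (u, v)) t
         (fun y : R => scal y df) (fun y : R => scal y dg) (fun u v => (u, v)) Hf Hg).
(* Pairing, seen as a map on the product, is the identity and so is its own differential. *)
assert (E : (fun p : U * V => (fst p, snd p)) = (fun p => p)).
{ apply functional_extensionality. intros [u v]. reflexivity. }
exact (eq_ind_r (fun h : U * V -> U * V => filterdiff (U := prod_NormedModule R_AbsRing U V)
         (V := prod_NormedModule R_AbsRing U V) h (locally (f t, g t)) h) (filterdiff_id _) E).
Qed.

Lemma is_derive_vec3 (a b c : R -> R) (t da db dc : R) :
  is_derive a t da -> is_derive b t db -> is_derive c t dc ->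
  is_derive (fun s => vec3 (a s) (b s) (c s)) t (vec3 da db dc).
Proof. intros Ha Hb Hc. apply is_derive_pair; [apply is_derive_pair|]; assumption. Qed.

Lemma vec3_plus (a b c a' b' c' : R) :
  plus (vec3 a b c) (vec3 a' b' c') = vec3 (a + a') (b + b') (c + c').
Proof. reflexivity. Qed.

Lemma vec3_inj (a b c a' b' c' : R) : vec3 a b c = vec3 a' b' c' -> a = a' /\ b = b' /\ c = c'.
Proof. intros H. injection H. auto. Qed.

(** With the distance supplied as [D], the attraction contains no square root and the equations of
    motion reduce to field identities. *)
Lemma attraction_at_distance (m D a1 a2 a3 b1 b2 b3 : R) :
  0 <= D -> (b1 - a1) ^ 2 + (b2 - a2) ^ 2 + (b3 - a3) ^ 2 = D ^ 2 ->
  attraction m (vec3 a1 a2 a3) (vec3 b1 b2 b3)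
  = vec3 (m / D ^ 3 * (b1 - a1)) (m / D ^ 3 * (b2 - a2)) (m / D ^ 3 * (b3 - a3)).
Proof.
intros HD H. unfold attraction.
change (minus (vec3 b1 b2 b3) (vec3 a1 a2 a3)) with (vec3 (b1 - a1) (b2 - a2) (b3 - a3)).
rewrite norm_R3, H, sqrt_pow2 by exact HD. reflexivity.
Qed.

(** [w] is the height of [x] above [y] and [z]. The weights satisfy [a - b = 1] and
    [m1 * a + 2 * m2 * b = 0], which places the centre of mass at the origin. The bodies [y] and [z]
    are opposite at radius 1/S, hence at distance 2/S, and [x] is at distance D/S from each. *)
Lemma isosceles_solution (m1 m2 e : R) (S DS V DV TH : R -> R) :
  0 < m1 -> 0 < m2 -> (forall t, 0 < S t) ->
  (forall t, is_derive TH t (S t ^ 2)) ->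
  (forall t, is_derive S t (S t ^ 2 * DS t)) ->
  (forall t, is_derive DS t
     (S t ^ 2 * (- S t + (m1 * / sqrt (1 + (e * V t) ^ 2) ^ 3 + m2 / 4)))) ->
  (forall t, is_derive V t (S t ^ 2 * DV t)) ->
  (forall t, is_derive DV t
     (S t ^ 2 * (- V t - m2 * / S t * (2 * / sqrt (1 + (e * V t) ^ 2) ^ 3 - 1 / 4) * V t))) ->
  let a := 2 * m2 / (2 * m2 + m1) in
  let b := - (m1 / (2 * m2 + m1)) in
  let w t := e * V t / S t in
  let dw t := e * (DV t * S t - V t * DS t) in
  three_body_solution m1 m2
    (fun t => vec3 0 0 (a * w t))
    (fun t => vec3 (cos (TH t) / S t) (sin (TH t) / S t) (b * w t))
    (fun t => vec3 (- (cos (TH t) / S t)) (- (sin (TH t) / S t)) (b * w t))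
    (fun t => vec3 0 0 (a * dw t))
    (fun t => vec3 (- DS t * cos (TH t) - S t * sin (TH t))
                   (- DS t * sin (TH t) + S t * cos (TH t)) (b * dw t))
    (fun t => vec3 (DS t * cos (TH t) + S t * sin (TH t))
                   (DS t * sin (TH t) - S t * cos (TH t)) (b * dw t)).
Proof.
intros Hm1 Hm2 HS HTH HdS HdDS HdV HdDV a b w dw t.
assert (HSt := HS t).
assert (Hsc := sin2_cos2 (TH t)). unfold Rsqr in Hsc.
assert (Hw : is_derive w t (dw t)).
{ unfold w, dw. auto_derive.
  - repeat split; try lra; eexists; [apply HdV | apply HdS].
  - change (fun x : R => V x) with V. change (fun x : R => S x) with S.
    rewrite (is_derive_unique _ _ _ (HdV t)), (is_derive_unique _ _ _ (HdS t)). field. lra. }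
assert (Hdw : is_derive dw t
  (- (m1 + 2 * m2) * e * S t ^ 2 * V t * / sqrt (1 + (e * V t) ^ 2) ^ 3)).
{ specialize (HdDV t). specialize (HdDS t). revert HdDV HdDS.
  (* Once this factor is abstract, [field] does not ask for the root to be nonzero. *)
  generalize (/ sqrt (1 + (e * V t) ^ 2) ^ 3). intros Q HdDV HdDS.
  unfold dw. auto_derive.
  - repeat split; eexists; [apply HdDV | apply HdS | apply HdV | apply HdDS].
  - change (fun x : R => V x) with V. change (fun x : R => S x) with S.
    change (fun x : R => DV x) with DV. change (fun x : R => DS x) with DS.
    rewrite (is_derive_unique _ _ _ (HdV t)), (is_derive_unique _ _ _ (HdS t)).
    rewrite (is_derive_unique _ _ _ HdDV), (is_derive_unique _ _ _ HdDS). field. lra. }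
assert (Hc : is_derive (fun t => cos (TH t) / S t) t (- DS t * cos (TH t) - S t * sin (TH t))).
{ auto_derive.
  - repeat split; try lra; eexists; [apply HTH | apply HdS].
  - change (fun x : R => TH x) with TH. change (fun x : R => S x) with S.
    rewrite (is_derive_unique _ _ _ (HTH t)), (is_derive_unique _ _ _ (HdS t)). field. lra. }
assert (Hs : is_derive (fun t => sin (TH t) / S t) t (- DS t * sin (TH t) + S t * cos (TH t))).
{ auto_derive.
  - repeat split; try lra; eexists; [apply HTH | apply HdS].
  - change (fun x : R => TH x) with TH. change (fun x : R => S x) with S.
    rewrite (is_derive_unique _ _ _ (HTH t)), (is_derive_unique _ _ _ (HdS t)). field. lra. }
(* The inward horizontal acceleration of [y] and [z]: the pull of [x] and the mutual pull, with 1/4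
   from the distance 2/S. *)
set (P := S t ^ 2 * (m1 * / sqrt (1 + (e * V t) ^ 2) ^ 3 + m2 / 4)).
assert (Hdc : is_derive (fun t => - DS t * cos (TH t) - S t * sin (TH t)) t (- P * cos (TH t))).
{ auto_derive.
  - repeat split; eexists; [apply HdDS | apply HTH | apply HdS | apply HTH].
  - change (fun x : R => TH x) with TH. change (fun x : R => S x) with S.
    change (fun x : R => DS x) with DS.
    rewrite (is_derive_unique _ _ _ (HTH t)), (is_derive_unique _ _ _ (HdS t)).
    rewrite (is_derive_unique _ _ _ (HdDS t)). unfold P. ring. }
assert (Hds : is_derive (fun t => - DS t * sin (TH t) + S t * cos (TH t)) t (- P * sin (TH t))).
{ auto_derive.
  - repeat split; eexists; [apply HdDS | apply HTH | apply HdS | apply HTH].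
  - change (fun x : R => TH x) with TH. change (fun x : R => S x) with S.
    change (fun x : R => DS x) with DS.
    rewrite (is_derive_unique _ _ _ (HTH t)), (is_derive_unique _ _ _ (HdS t)).
    rewrite (is_derive_unique _ _ _ (HdDS t)). unfold P. ring. }
assert (Hab : a - b = 1) by (unfold a, b; field; lra).
set (D := sqrt (1 + (e * V t) ^ 2)) in *.
assert (HD : D ^ 2 = 1 + (e * V t) ^ 2).
{ apply pow2_sqrt. generalize (pow2_ge_0 (e * V t)). lra. }
assert (HD1 : 0 < D).
{ apply sqrt_lt_R0. generalize (pow2_ge_0 (e * V t)). lra. }
assert (Hdist : (cos (TH t) / S t) ^ 2 + (sin (TH t) / S t) ^ 2 + w t ^ 2 = (D / S t) ^ 2).
{ replace ((D / S t) ^ 2) with (D ^ 2 / S t ^ 2) by (field; lra).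
  rewrite HD. unfold w.
  replace 1 with (sin (TH t) * sin (TH t) + cos (TH t) * cos (TH t)) by exact Hsc.
  field. lra. }
assert (Hdist2 : (2 * (cos (TH t) / S t)) ^ 2 + (2 * (sin (TH t) / S t)) ^ 2 = (2 / S t) ^ 2).
{ replace ((2 / S t) ^ 2) with (4 * 1 / S t ^ 2) by (field; lra).
  replace 1 with (sin (TH t) * sin (TH t) + cos (TH t) * cos (TH t)) by exact Hsc.
  field. lra. }
assert (HDS : 0 <= D / S t) by (left; apply Rdiv_lt_0_compat; lra).
assert (H2S : 0 <= 2 / S t) by (left; apply Rdiv_lt_0_compat; lra).
assert (Hne : ~ (cos (TH t) / S t = 0 /\ sin (TH t) / S t = 0)).
{ intros [E1 E2].
  assert (E3 : cos (TH t) = cos (TH t) / S t * S t) by (field; lra).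
  assert (E4 : sin (TH t) = sin (TH t) / S t * S t) by (field; lra).
  rewrite E1 in E3. rewrite E2 in E4. rewrite E3, E4 in Hsc. lra. }
assert (Hneg : forall f l, is_derive f t l -> is_derive (fun t => - f t) t (- l))
  by (intros f l; apply (is_derive_opp f t l)).
repeat match goal with |- _ /\ _ => split end.
- intros E. apply vec3_inj in E. apply Hne. lra.
- intros E. apply vec3_inj in E. apply Hne. lra.
- intros E. apply vec3_inj in E. apply Hne. lra.
- apply is_derive_vec3; [apply (is_derive_const 0) | apply (is_derive_const 0) | apply is_derive_scal, Hw].
- apply is_derive_vec3; [exact Hc | exact Hs | apply is_derive_scal, Hw].
- replace (DS t * cos (TH t) + S t * sin (TH t)) with (- (- DS t * cos (TH t) - S t * sin (TH t))) by ring.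
  replace (DS t * sin (TH t) - S t * cos (TH t)) with (- (- DS t * sin (TH t) + S t * cos (TH t))) by ring.
  apply is_derive_vec3; [apply Hneg, Hc | apply Hneg, Hs | apply is_derive_scal, Hw].
- rewrite (attraction_at_distance m2 (D / S t)), (attraction_at_distance m2 (D / S t)), vec3_plus;
    try exact HDS; try (rewrite <- Hdist; replace a with (b + 1) by lra; ring).
  evar_last.
  + eapply is_derive_vec3; [apply (is_derive_const 0) | apply (is_derive_const 0) | apply is_derive_scal, Hdw].
  + unfold zero; simpl. unfold w, a, b. f_equal; field; lra.
- rewrite (attraction_at_distance m1 (D / S t)), (attraction_at_distance m2 (2 / S t)), vec3_plus;
    try exact HDS; try exact H2S;
    try (rewrite <- Hdist; replace a with (b + 1) by lra; ring);
    try (rewrite <- Hdist2; ring).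
  evar_last.
  + eapply is_derive_vec3; [exact Hdc | exact Hds | apply is_derive_scal, Hdw].
  + unfold P, w, a, b. f_equal; field; lra.
- rewrite (attraction_at_distance m1 (D / S t)), (attraction_at_distance m2 (2 / S t)), vec3_plus;
    try exact HDS; try exact H2S;
    try (rewrite <- Hdist; replace a with (b + 1) by lra; ring);
    try (rewrite <- Hdist2; ring).
  evar_last.
  + eapply is_derive_vec3.
    * apply (is_derive_ext (fun t => - (- DS t * cos (TH t) - S t * sin (TH t)))); [intros r; apply Rminus_diag_uniq; ring|].
      apply Hneg, Hdc.
    * apply (is_derive_ext (fun t => - (- DS t * sin (TH t) + S t * cos (TH t)))); [intros r; apply Rminus_diag_uniq; ring|].
      apply Hneg, Hds.
    * apply is_derive_scal, Hdw.
  + unfold P, w, a, b. f_equal; field; lra.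
Qed.

(** With [m1 = k - kap / 4] the energy is [kap - 2 * kap * k] plus the small vertical kinetic term
    [X]. At [k = 1] and [X = 0] the expression defining the family is - kap (4 - kap)^2, negative
    with room for the perturbation. *)
Lemma family_B_near_circular (k kap e df : R) :
  8 / 7 <= kap <= 16 / 7 -> Rabs (k - 1) <= 1 / 100 -> 0 < e <= 1 / 100 ->
  df = 2 * kap / (2 * kap + (k - kap / 4)) * e ->
  let q := mk_parameter 1 1 df (k - kap / 4) kap in
  admissible q /\ Defs.c2 q < 0 /\ Defs.c1 q <> 0 /\
  8 * m1 q * m2 q ^ 2 + m2 q ^ 3 + 16 * Defs.c2 q * Defs.c1 q ^ 2 < 0.
Proof.
intros Hkap Hk He Hdf. apply Rabs_le_between in Hk.
unfold admissible, Defs.c2, Defs.c1. cbn [y10 dy20 df0 m1 m2].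
set (X := (k - kap / 4) / (4 * kap) * (k - kap / 4 + 2 * kap) * df ^ 2).
assert (HX : X <= 1 / 100).
{ assert (E : X = (k - kap / 4) * e ^ 2 * (kap / (2 * kap + (k - kap / 4)))).
  { unfold X. rewrite Hdf. field. lra. }
  assert (H1 : kap / (2 * kap + (k - kap / 4)) <= 1).
  { apply (Rmult_le_reg_r (2 * kap + (k - kap / 4))); [lra|].
    unfold Rdiv. rewrite Rmult_assoc, Rinv_l by lra. lra. }
  assert (H2 : 0 <= kap / (2 * kap + (k - kap / 4))).
  { apply Rmult_le_pos; [lra | left; apply Rinv_0_lt_compat; lra]. }
  assert (H3 : 0 <= (k - kap / 4) * e ^ 2 <= 1 / 100).
  { assert (0 <= e ^ 2 <= 1 / 100) by nra. nra. }
  rewrite E. nra. }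
clearbody X.
replace (kap * 1 ^ 2 - kap / (2 * 1) * (4 * (k - kap / 4) + kap) + X)
  with (kap - 2 * kap * k + X) by field.
split; [|split; [|split]].
- lra.
- nra.
- lra.
- replace (8 * (k - kap / 4) * kap ^ 2 + kap ^ 3 + 16 * (kap - 2 * kap * k + X) * (1 * 1) ^ 2)
    (* Here [kap * (4 - kap)] is at least 1 and the second factor is at least 12/7 - 8/100, whereas
       [16 * X] is at most 16/100. *)
    with (- (kap * (4 - kap)) * ((4 - kap) + 8 * (k - 1)) + 16 * X) by field.
  assert (1 <= kap * (4 - kap)) by nra. nra.
Qed.

(** The initial vertical velocity of [x] is determined by the trajectory and is here positive but
    arbitrarily small; this is what tells infinitely many solutions apart. *)
Lemma periodic_solutions_small_velocity :
  exists e0, 0 < e0 /\ forall e, 0 < e < e0 ->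
  exists s : trajectory,
    ((exists q, family_B q s) /\ periodic s /\ nontrivial s) /\
    exists df, 0 < df < e /\
      is_derive (fun t => snd (fst (fst s) t : R * R * R)) 0 df.
Proof.
destruct reduced_periodic_solution as [e0 [He0 Hred]].
exists e0. split; [lra|]. intros e He.
destruct (Hred e He) as [k [kap [s [ds [v [dv [Hkap [Hk [s0 [ds0 [v0 [dv0
  [Hs [Hds [Ps [Pv [Ds [Dds [Dv Ddv]]]]]]]]]]]]]]]]]]]. clear Hred.
destruct (time_change s ds Hs Hds Ds Ps) as [th [T [HT [th0 [Dth Pth]]]]].
set (a := 2 * kap / (2 * kap + (k - kap / 4))).
set (b := - ((k - kap / 4) / (2 * kap + (k - kap / 4)))).
destruct (family_B_near_circular k kap e (a * e) Hkap Hk ltac:(lra) eq_refl)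
  as [Hadm [Hc2 [Hc1 HB]]].
destruct Hadm as [_ [Hm1 Hm2]]. cbn [m1 m2] in Hm1, Hm2.
assert (Hcomp : forall f df, (forall t, is_derive f t (df t)) ->
          forall t, is_derive (fun t => f (th t)) t (s (th t) ^ 2 * df (th t))).
{ intros f df Hf t. apply (is_derive_comp f th); [apply Hf | apply Dth]. }
assert (Hsol := isosceles_solution (k - kap / 4) kap e (fun t => s (th t)) (fun t => ds (th t))
  (fun t => v (th t)) (fun t => dv (th t)) th Hm1 Hm2
  (fun t => Rlt_le_trans 0 (1 / 2) _ ltac:(lra) (proj1 (Hs (th t)))) Dth
  (Hcomp _ _ Ds) (Hcomp _ _ Dds) (Hcomp _ _ Dv) (Hcomp _ _ Ddv)).
cbv zeta in Hsol. fold a b in Hsol.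
set (x := fun t => vec3 0 0 (a * (e * v (th t) / s (th t)))) in Hsol.
set (y := fun t => vec3 (cos (th t) / s (th t)) (sin (th t) / s (th t))
                        (b * (e * v (th t) / s (th t)))) in Hsol.
set (z := fun t => vec3 (- (cos (th t) / s (th t))) (- (sin (th t) / s (th t)))
                        (b * (e * v (th t) / s (th t)))) in Hsol.
assert (Hx : is_derive (fun t => snd (x t : R * R * R)) 0 (a * e)).
{ simpl. evar_last.
  - apply is_derive_scal. apply is_derive_div.
    + apply is_derive_scal. apply (Hcomp _ _ Dv).
    + apply (Hcomp _ _ Ds).
    + rewrite th0, s0. lra.
  - cbv beta. rewrite th0, s0, v0, dv0, ds0. field. }
assert (Ha : 0 < a < 1).
{ unfold a. split; [apply Rdiv_lt_0_compat; lra|].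
  apply (Rmult_lt_reg_r (2 * kap + (k - kap / 4))); [lra|].
  unfold Rdiv at 1. rewrite Rmult_assoc, Rinv_l by lra. lra. }
assert (Hdf : 0 < a * e < e) by nra.
exists (x, y, z). split; [split; [|split]|].
- exists (mk_parameter 1 1 (a * e) (k - kap / 4) kap).
  split; [|exact HB]. split; [|split; [|split; assumption]].
  + repeat split; cbn [y10 m1 m2]; lra.
  + eexists _, _, _. split; [exact Hsol|].
    cbn [y10 dy20 df0 m1 m2]. unfold x, y, z. rewrite th0, s0, v0, dv0, ds0, sin_0, cos_0.
    repeat split; unfold b, a; f_equal; field; lra.
(* After time [T] the angle has advanced by 2 pi, so [cos], [sin], [s] and [v] all return to their
   values. *)
- exists T. split; [exact HT|]. intros t. unfold x, y, z.
  rewrite Pth, Ps, Pv, cos_plus, sin_plus, cos_2PI, sin_2PI, !Rmult_1_r, !Rmult_0_r,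
    Rminus_0_r, Rplus_0_r. repeat split.
(* If [x] vanished identically, its initial vertical velocity [a * e] would be 0. *)
- intros H0.
  assert (E : a * e = 0).
  { rewrite <- (is_derive_unique _ _ _ Hx).
    rewrite (Derive_ext _ (fun _ => 0)); [apply Derive_const|].
    intros t. rewrite H0. reflexivity. }
  lra.
- exists (a * e). split; [exact Hdf | exact Hx].
Qed.

(** Induction on finiteness, taking a minimum at each added element. [value] is a relation because
    the derivative of an arbitrary trajectory need not exist. *)
Lemma finite_positive_values_bounded_below {X : Type} (value : X -> R -> Prop) (A : Ensemble X) :
  (forall s r r', value s r -> value s r' -> r = r') -> Finite_sets.Finite X A ->
  exists d, 0 < d /\ forall s r, A s -> value s r -> 0 < r -> d <= r.
Proof.
intros Hfun HA. induction HA as [|A HA [d [Hd IH]] s Hs].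
- exists 1. split; [lra|]. intros s r [].
- destruct (excluded_middle_informative (exists r, value s r /\ 0 < r)) as [[r0 [Hr0 Hpos]] | Hno].
  + exists (Rmin d r0). split; [apply Rmin_glb_lt; assumption|].
    intros s' r Hs' Hr Hr1. destruct Hs' as [s' Hs' | s' Hs'].
    * eapply Rle_trans; [apply Rmin_l | apply (IH s'); assumption].
    * destruct Hs'. rewrite (Hfun s r r0 Hr Hr0). apply Rmin_r.
  + exists d. split; [exact Hd|].
    intros s' r Hs' Hr Hr1. destruct Hs' as [s' Hs' | s' Hs'].
    * apply (IH s'); assumption.
    * destruct Hs'. exfalso. apply Hno. exists r. split; assumption.
Qed.

Theorem theorem2p8 :
  ~ Finite_sets.Finite trajectory
      (fun s : trajectory =>
         (exists q : parameter, family_B q s) /\ periodic s /\ nontrivial s).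
Proof.
intros Hfin.
destruct (finite_positive_values_bounded_below
  (fun (s : trajectory) r => is_derive (fun t => snd (fst (fst s) t : R * R * R)) 0 r)
  _ (fun s r r' H H' => eq_trans (eq_sym (is_derive_unique _ _ _ H)) (is_derive_unique _ _ _ H'))
  Hfin) as [d [Hd Hmin]].
destruct periodic_solutions_small_velocity as [e0 [He0 H]].
(* This choice gives a solution whose velocity is positive and below [d], the lower bound forced by
   finiteness. *)
destruct (H (Rmin e0 d / 2)) as [s [Hs [df [Hdf Hder]]]].
{ generalize (Rmin_glb_lt e0 d 0 He0 Hd) (Rmin_l e0 d). lra. }
generalize (Hmin s df Hs Hder (proj1 Hdf)) (Rmin_r e0 d) (Rmin_glb_lt e0 d 0 He0 Hd). lra.
Qed.
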